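(* There exists an ergodic measure-preserving transformation $T$ of a standard probability space $(X,\mathfrak B,\mu)$ such that $(X,\mathfrak B,\mu,T)$ has Kolmogorov--Sinai entropy zero and is uniformly measure-theoretically$^+$ chaotic.
   Context: The upper density of an increasing sequence $(n_i)$ of positive integers is $\limsup_{N\to\infty}\frac1N\#\{i:n_i\le N\}$. Let $T$ be a measure-preserving transformation of a standard probability space $(X,\mathfrak B,\mu)$ ($\mathfrak B$ complete). A sequence $(\mathscr P_k)_{k\ge1}$ of finite measurable partitions is refining if $\mathscr P_{k+1}$ refines $\mathscr P_k$ for every $k$ and $\mathfrak B$ is the smallest complete sigma-algebra containing all the $\mathscr P_k$. A pair $(x,y)$ is $(\mathscr P_k)^+$-scrambled if (i) there is an increasing sequence $n_i$ of upper density 1 such that for every $k$ and all large enough $i$, $T^{n_i}x$ and $T^{n_i}y$ lie in the same atom of $\mathscr P_k$; and (ii) for every $\eta\in(0,1)$ there are an increasing sequence $m_{\eta,i}$ of upper density at least $\eta$ and an index $k_\eta$ such that for every $i$, $T^{m_{\eta,i}}x$ and $T^{m_{\eta,i}}y$ lie in different atoms of $\mathscr P_{k_\eta}$. A set is uniformly $(\mathscr P_k)^+$-scrambled if every pair of its distinct elements is $(\mathscr P_k)^+$-scrambled with a function $\eta\mapsto k_\eta$ that is common to all such pairs. The system is uniformly measure-theoretically$^+$ chaotic if for every refining sequence of finite measurable partitions $(\mathscr P_k)$ there exists an uncountable uniformly $(\mathscr P_k)^+$-scrambled set. *)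

(* Defs.v *)
From HB Require Import structures.
From mathcomp Require Import all_boot all_order all_algebra.
From mathcomp Require Import all_classical all_reals all_analysis.

Set Implicit Arguments.
Unset Strict Implicit.
Unset Printing Implicit Defensive.

Import Order.TTheory GRing.Theory Num.Theory.
Import numFieldNormedType.Exports.

Local Open Scope classical_set_scope.
Local Open Scope ring_scope.

Definition completed_measurable d (Y : measurableType d) (R : realType)
    (nu : probability Y R) : set (set Y) :=
  [set B | exists U V : set Y,
    [/\ measurable U, measurable V, U `<=` B, B `<=` V
      & nu (V `\` U) = 0%E]].

(** The space [(X, mu)] is complete and isomorphic modulo null sets, via a
    bijection [f : X0 -> Y0] between sets of full measure, to the completion of
    a Borel probability measure [nu] on a Polish space [Y]. *)
Definition standard_probability (R : realType) d (X : measurableType d)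
    (mu : probability X R) : Prop :=
  measure_is_complete mu /\
  exists (Y : completePseudoMetricType R)
         (nu : probability (g_sigma_algebraType (@open Y)) R)
         (X0 : set X) (Y0 : set (g_sigma_algebraType (@open Y)))
         (f : X -> g_sigma_algebraType (@open Y)),
    [/\ hausdorff_space Y /\ @second_countable Y,
        measurable X0 /\ mu X0 = 1%E,
        measurable Y0 /\ nu Y0 = 1%E,
        set_bij X0 Y0 f &
        (forall B, B `<=` Y0 ->
           measurable (X0 `&` f @^-1` B) <-> completed_measurable nu B) /\
        (forall B, measurable B -> mu (X0 `&` f @^-1` B) = nu B)].

Definition measure_preserving (R : realType) d (X : measurableType d)
    (mu : probability X R) (T : X -> X) : Prop :=
  measurable_fun setT T /\
  forall A, measurable A -> mu (T @^-1` A) = mu A.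

Definition ergodic (R : realType) d (X : measurableType d)
    (mu : probability X R) (T : X -> X) : Prop :=
  forall A, measurable A -> T @^-1` A = A -> mu A = 0%E \/ mu A = 1%E.

Record finite_partition d (X : measurableType d) := FinitePartition {
  natoms : nat ;
  atom :> 'I_natoms -> set X ;
  measurable_atom : forall i, measurable (atom i) ;
  partition_atom : partition [set: 'I_natoms] atom [set: X] }.

Definition same_atom d (X : measurableType d) (P : finite_partition X)
    (x y : X) : Prop :=
  exists i, P i x /\ P i y.

Definition refines d (X : measurableType d) (Q P : finite_partition X) : Prop :=
  forall j, exists i, Q j `<=` P i.

(** The set of points whose [P]-name starts with the word [w]. The nonempty
    cylinders of length [n] are the atoms of the join of [T^-i P], [i < n]. *)
Definition cylinder d (X : measurableType d) (T : X -> X)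
    (P : finite_partition X) n (w : {ffun 'I_n -> 'I_(natoms P)}) : set X :=
  [set x | forall i : 'I_n, P (w i) (iter i T x)].

(** Empty cylinders contribute [0], since [0 * ln 0 = 0]. *)
Definition join_entropy (R : realType) d (X : measurableType d)
    (mu : probability X R) (T : X -> X) (P : finite_partition X) (n : nat) : R :=
  - \sum_(w : {ffun 'I_n -> 'I_(natoms P)})
      fine (mu (cylinder T w)) * ln (fine (mu (cylinder T w))).

(** The limit exists by subadditivity when [T] preserves [mu]. *)
Definition partition_entropy (R : realType) d (X : measurableType d)
    (mu : probability X R) (T : X -> X) (P : finite_partition X) : \bar R :=
  limn (fun n => (join_entropy mu T P n / n%:R)%:E).

Definition KS_entropy (R : realType) d (X : measurableType d)
    (mu : probability X R) (T : X -> X) : \bar R :=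
  ereal_sup (range (fun P : finite_partition X => partition_entropy mu T P)).

(** A sub-sigma-algebra is complete when it contains every subset of every
    [mu]-null set. *)
Definition refining (R : realType) d (X : measurableType d)
    (mu : probability X R) (P : nat -> finite_partition X) : Prop :=
  (forall k, refines (P k.+1) (P k)) /\
  (@measurable d X : set (set X)) =
    <<s (\bigcup_k range (P k)) `|` mu.-negligible >>.

Definition increasing_pos_seq (n : nat -> nat) : Prop :=
  (forall i, 0 < n i)%N /\ {homo n : i j / (i < j)%N}.

(** Sequences are indexed from [0]. Restricting the count to [i < N] loses
    nothing: an increasing sequence of positive integers satisfies [i < n i]. *)
Definition upper_density (R : realType) (n : nat -> nat) : \bar R :=
  limn_esup (fun N : nat =>
    (#|[pred i : 'I_N | (n i <= N)%N]|%:R / N%:R : R)%:E).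

Definition scrambled_with (R : realType) d (X : measurableType d) (T : X -> X)
    (P : nat -> finite_partition X) (kappa : R -> nat) (x y : X) : Prop :=
  (exists n, [/\ increasing_pos_seq n, upper_density R n = 1%E &
     forall k, \forall i \near \oo,
       same_atom (P k) (iter (n i) T x) (iter (n i) T y)]) /\
  (forall eta : R, 0 < eta < 1 ->
     exists m, [/\ increasing_pos_seq m, (eta%:E <= upper_density R m)%E &
       forall i,
         ~ same_atom (P (kappa eta)) (iter (m i) T x) (iter (m i) T y)]).

Definition uniformly_scrambled (R : realType) d (X : measurableType d)
    (T : X -> X) (P : nat -> finite_partition X) (S : set X) : Prop :=
  exists kappa : R -> nat, forall x y, S x -> S y -> x <> y ->
    scrambled_with T P kappa x y.

Definition uniformly_chaotic (R : realType) d (X : measurableType d)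
    (mu : probability X R) (T : X -> X) : Prop :=
  forall P, refining mu P ->
    exists S : set X, ~ countable S /\ uniformly_scrambled R T P S.

(* Main.v *)
From HB Require Import structures.
From mathcomp Require Import all_boot all_order all_algebra.
From mathcomp Require Import zify ring lra.
From mathcomp Require Import all_classical all_reals all_analysis.
From mathcomp Require Import measurable_realfun.
From Stdlib Require PeanoNat.
Require Import Defs.

Set Implicit Arguments.
Unset Strict Implicit.
Unset Printing Implicit Defensive.

(** The transformation is a skew product over the dyadic odometer. A point is
    a sequence of fair coin tosses; its even coordinates are the digits of a
    dyadic integer, its odd coordinates a scenery, one bit on each site
    [s : nat]. The odometer adds 1 to the dyadic integer, and the scenery is
    translated by [jump], where translations of the sites are given by the
    bitwise exclusive or. The jump is the change of the number [active_code]
    written by every second digit, so as long as no carry leaves the first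
    [4 * j] digits, the scenery seen at time [n] is the initial scenery
    translated by [walk j _ n], the total change of that number ([scen_iter]).
    During the first [8 ^ j] times the walk stays below [4 ^ j], and it spends
    at most [L * 4 ^ j] times in any window of [L] sites ([card_walk]): it
    sees few sites, and concentrates on none of them.

    Seeing few sites gives entropy zero. With probability close to 1, the first
    [8 ^ j] values of a function of finitely many coordinates are determined by
    [O(4 ^ j)] initial bits ([skew_agree]). An arbitrary partition is such a
    function up to a small error, and coding the errors letter by letter shows
    that its names of length [n] have entropy [o(n)] ([KS_entropy_skew]).

    Leaving every window gives ergodicity. Given the digits, the visits to a
    cylinder are events about disjoint windows of the scenery, apart from a
    proportion of order [2 ^ - j] of the pairs of times; the second moment
    method then shows that the ergodic averages converge in measure along the
    times [8 ^ j] ([equidistributed_skew]).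

    Leaving every window also gives the scrambled set. Fix levels [lev t] that
    grow fast. Most of the times before [8 ^ lev t.+1] are spent on the shell of
    the sites from [4 ^ lev t] to [4 ^ lev t.+1]. For a sequence [w] of bits,
    flip the scenery of [x] on whole shells, according to a colour
    [color w t.+1] that is infinitely often the same for all [w] and infinitely
    often equal to each [w i]. If [w] and [w'] have the same colour on a shell,
    then for most of the corresponding times the orbits of [twist lev w x] and
    [twist lev w' x] agree on many coordinates, hence are mostly in the same
    atom of the partition in question; if the colours differ, the orbits differ
    at the scenery of site 0, and a partition [P k] fine enough to nearly
    determine that bit separates them. The index [k] depends on the required
    proportion of the times only, whence the uniformity. The words nearly and
    mostly hide exceptional sets, which the orbit of a point must visit
    rarely at all late scales. Almost every point does so, by equidistribution
    and the lemma of Borel and Cantelli. Finally each twist preserves the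
    measure, so by Fubini's theorem there is one [x] such that [twist lev w x] is
    such a point for uncountably many [w] ([uncountable_avoiding]). *)

(** * Bitwise exclusive or *)

Module Nat := PeanoNat.Nat.
Local Notation "a ^^ b" := (Nat.lxor a b) (at level 40, left associativity).

Lemma lxorA a b c : a ^^ (b ^^ c) = a ^^ b ^^ c.
Proof. by rewrite Nat.lxor_assoc. Qed.

Lemma lxorC a b : a ^^ b = b ^^ a.
Proof. exact: Nat.lxor_comm. Qed.

Lemma lxorK a b : a ^^ b ^^ b = a.
Proof. by rewrite Nat.lxor_assoc Nat.lxor_nilpotent Nat.lxor_0_r. Qed.

Lemma lxorI b : injective (fun a => a ^^ b).
Proof. by move=> a c e; rewrite -(lxorK a b) e lxorK. Qed.

Lemma lxorKK s a b : (s ^^ a) ^^ (s ^^ b) = a ^^ b.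
Proof. by rewrite (lxorC s a) -lxorA (lxorA s) Nat.lxor_nilpotent Nat.lxor_0_l. Qed.

Lemma pow2E m : Nat.pow 2 m = 2 ^ m.
Proof. by elim: m => //= m ->; rewrite expnS; lia. Qed.

Lemma lxor_lt_pow2 m a b : a < 2 ^ m -> b < 2 ^ m -> a ^^ b < 2 ^ m.
Proof.
case: m => [|m]; first by rewrite expn0 !ltnS !leqn0 => /eqP-> /eqP->.
rewrite -pow2E => /ltP am /ltP bm; apply/ltP.
have log2_lt c : (c < Nat.pow 2 m.+1)%coq_nat -> (Nat.log2 c < m.+1)%coq_nat.
  have [->|/Nat.neq_0_lt_0 c0] := Nat.eq_dec c 0; first by move=> _; apply/ltP.
  by move/Nat.log2_lt_pow2; exact.
have [->|/Nat.neq_0_lt_0 ab0] := Nat.eq_dec (a ^^ b) 0.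
  by apply/ltP; rewrite pow2E expn_gt0.
apply/Nat.log2_lt_pow2 => //.
have := log2_lt _ am; have := log2_lt _ bm; have := Nat.log2_lxor a b; lia.
Qed.

(** A shell of sites records the top binary digits, and translation by a small
    number changes low digits only. *)
Lemma lxor_shell r a b s g : r <= a -> s < 2 ^ r ->
  2 ^ a <= g < 2 ^ b -> 2 ^ a <= s ^^ g < 2 ^ b.
Proof.
move=> ra sr /andP[ag gb].
have sa : s < 2 ^ a by rewrite (leq_trans sr)// leq_exp2l.
have sb : s < 2 ^ b by rewrite (ltn_trans sa)// (leq_ltn_trans ag).
rewrite lxor_lt_pow2 // andbT leqNgt; apply/negP => sga.
have := lxor_lt_pow2 sa sga; rewrite lxorA Nat.lxor_nilpotent Nat.lxor_0_l.
by rewrite ltnNge ag.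
Qed.

(** The sum of the [2 ^ i] over the [i < m] in [P], written with the exclusive
    or so that the code of a pointwise exclusive or is immediate. *)
Fixpoint bits_code m (P : nat -> bool) : nat :=
  if m is m'.+1 then bits_code m' P ^^ (if P m' then 2 ^ m' else 0) else 0.

Lemma bits_code_lt m P : bits_code m P < 2 ^ m.
Proof.
elim: m => //= m IH; apply: lxor_lt_pow2.
  by rewrite (ltn_trans IH)// ltn_exp2l.
by case: ifP => _; rewrite ?expn_gt0// ltn_exp2l.
Qed.

Lemma bits_code_inj m P Q : bits_code m P = bits_code m Q ->
  forall i, i < m -> P i = Q i.
Proof.
have testS n c p : c < 2 ^ n ->
    c ^^ (if p then 2 ^ n else 0) < 2 ^ n = ~~ p.
  case: p => cn; last by rewrite Nat.lxor_0_r.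
  apply/negP => h; have := lxor_lt_pow2 h cn.
  by rewrite lxorC lxorA Nat.lxor_nilpotent Nat.lxor_0_l ltnn.
elim: m => //= m IH e.
have PQm : P m = Q m.
  apply: negb_inj; rewrite -(testS m (bits_code m P)) ?bits_code_lt//.
  by rewrite e testS ?bits_code_lt.
move: e; rewrite PQm => /lxorI /IH {}IH i.
by rewrite ltnS leq_eqVlt => /predU1P[->//|/IH].
Qed.

Lemma eq_bits_code m P Q : (forall i, i < m -> P i = Q i) ->
  bits_code m P = bits_code m Q.
Proof.
elim: m => //= m IH e; rewrite IH ?e// => i im.
by rewrite e// (ltn_trans im).
Qed.

Lemma bits_codeD m P Q :
  bits_code m P ^^ bits_code m Q = bits_code m (fun i => P i (+) Q i).
Proof.
elim: m => //= m <-; rewrite -!lxorA; congr (_ ^^ _).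
rewrite lxorC -lxorA; congr (_ ^^ _).
by case: (P m); case: (Q m); rewrite ?Nat.lxor_nilpotent ?Nat.lxor_0_r ?Nat.lxor_0_l.
Qed.

(** * The dyadic odometer *)

Definition odometer (y : nat -> bool) : nat -> bool :=
  fun i => y i (+) all y (iota 0 i).

Fixpoint low_value m (y : nat -> bool) : nat :=
  if m is m'.+1 then low_value m' y + y m' * 2 ^ m' else 0.

Lemma low_value_lt m y : low_value m y < 2 ^ m.
Proof. by elim: m => //= m IH; rewrite expnS; case: (y m); lia. Qed.

Lemma eq_low_value m y y' : (forall i, i < m -> y i = y' i) ->
  low_value m y = low_value m y'.
Proof.
elim: m => //= m IH e; rewrite IH ?e// => i im.
by rewrite e// (ltn_trans im).
Qed.

Lemma all_low_value m y : all y (iota 0 m) = ((low_value m y).+1 == 2 ^ m).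
Proof.
elim: m => // m IH; rewrite -addn1 iotaD all_cat IH /= andbT add0n addn1 expnS /=.
have := low_value_lt m y; move: (low_value m y) (2 ^ m) => v p vp.
by case: (y m); rewrite ?andbT ?andbF ?mul1n ?mul0n; lia.
Qed.

Lemma low_value_odometer m y :
  low_value m (odometer y) = (low_value m y).+1 %% 2 ^ m.
Proof.
elim: m => [|m IH /=]; first by rewrite modn1.
rewrite {}IH /odometer all_low_value.
have := low_value_lt m y; set v := low_value m y => vm.
have [e|ne] := eqVneq v.+1 (2 ^ m).
  rewrite e modnn add0n addbT; case: (y m) => /=; rewrite ?mul0n ?mul1n ?addn0.
    by rewrite -addSn e expnS mul2n addnn modnn.
  by rewrite modn_small// expnS; have := expn_gt0 2 m; lia.
rewrite addbF !modn_small ?addSn//; last by rewrite ltn_neqAle ne.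
rewrite expnS; case: (y m) => /=; lia.
Qed.

Lemma low_value_iter m n y :
  low_value m (iter n odometer y) = (low_value m y + n) %% 2 ^ m.
Proof.
elim: n => [|n IH]; first by rewrite addn0 modn_small// low_value_lt.
by rewrite iterS low_value_odometer IH -addn1 modnDml addn1 addnS.
Qed.

Lemma odometer_agree m y y' : (forall i, i < m -> y i = y' i) ->
  forall n i, i < m -> iter n odometer y i = iter n odometer y' i.
Proof.
move=> e; elim=> [|n IH] i im; first exact: e.
rewrite !iterS /odometer IH//; congr (_ (+) _).
apply: eq_in_all => k; rewrite mem_iota => ki; apply: IH; lia.
Qed.

(** On its first [m] digits the odometer is addition of 1 modulo [2 ^ m]. *)
Lemma odometer_inj m y n n' : n < 2 ^ m -> n' < 2 ^ m ->
  (forall i, i < m -> iter n odometer y i = iter n' odometer y i) -> n = n'.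
Proof.
move=> nm n'm /eq_low_value; rewrite !low_value_iter => /eqP.
by rewrite eqn_modDl !modn_small// => /eqP.
Qed.

(** Only the digits at odd positions are used: while the first [4 * j] digits run
    through [16 ^ j] values, the walk below has [4 ^ j] sites at its disposal. *)
Definition active_code m (y : nat -> bool) := bits_code m (fun i => y i.*2.+1).

Lemma active_code_lt m y : active_code m y < 2 ^ m.
Proof. exact: bits_code_lt. Qed.

(** Beyond the first [false] digit the odometer changes nothing, so the full
    change of [active_code] is already visible on a finite number of digits; the
    point with all digits [true] is negligible. *)
Definition jump (y : nat -> bool) : nat :=
  if pselect (exists i, ~~ y i) is left h then
    let m := (ex_minn h).+1 in active_code m (odometer y) ^^ active_code m y
  else 0.

(** Hence the jump is a coboundary as long as no carry leaves the first [m.*2]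
    digits. *)
Lemma jumpE m y : (exists2 i, i < m.*2 & ~~ y i) ->
  jump y = active_code m (odometer y) ^^ active_code m y.
Proof.
move=> [i im yi]; rewrite /jump; case: pselect => [h|[]]; last by exists i.
case: ex_minnP => t yt tmin.
have tm : t < m.*2 by rewrite (leq_ltn_trans (tmin _ yi)).
suff st k : t < k.*2 -> active_code k.+1 (odometer y) ^^ active_code k.+1 y =
    active_code k (odometer y) ^^ active_code k y.
  have st2 k l : t < k.*2 -> active_code (l + k) (odometer y) ^^ active_code (l + k) y =
    active_code k (odometer y) ^^ active_code k y.
    by move=> tk; elim: l => // l <-; rewrite addSn st//; lia.
  have [mt|tm'] := leqP m t.+1.
    by rewrite -(subnK mt) st2.
  by rewrite -{1 2}(subnK (ltnW tm')) st2//; lia.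
move=> tk; rewrite /active_code /= /odometer.
have -> : all y (iota 0 k.*2.+1) = false.
  by apply/negP => /allP /(_ t); rewrite mem_iota (negbTE yt) => /(_ _)/negP; apply; lia.
rewrite addbF -!lxorA; congr (_ ^^ _).
by rewrite lxorC lxorK.
Qed.

(** The odometer flips the digits up to the first [false] one and no other, so
    the change of their code is the code of all odd positions among them. *)
Lemma jump_first t (y : nat -> bool) : (forall k, k < t -> y k) -> ~~ y t ->
  jump y = bits_code t.+1 (fun i => i.*2 < t).
Proof.
move=> yt ynt; rewrite (@jumpE t.+1); last by exists t => //; lia.
rewrite /active_code bits_codeD; apply: eq_bits_code => i _.
rewrite /odometer addbC addbA addbb addFb.
have [it|it] := ltnP i.*2 t.
  by apply/allP => k; rewrite mem_iota => ki; apply: yt; lia.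
by apply/negP => /allP /(_ t); rewrite mem_iota (negbTE ynt) => /(_ _)/negP; apply; lia.
Qed.

Lemma jump_true (y : nat -> bool) : (forall k, y k) -> jump y = 0.
Proof.
move=> yT; rewrite /jump; case: pselect => // h; exfalso; case: h => k.
by rewrite yT.
Qed.

(** * The skew product *)

Definition base (x : nat -> bool) : nat -> bool := fun i => x i.*2.
Definition scen (x : nat -> bool) : nat -> bool := fun s => x s.*2.+1.

Definition skew (x : nat -> bool) : nat -> bool := fun i =>
  if odd i then scen x (i./2 ^^ jump (base x)) else odometer (base x) i./2.

Lemma base_skew x : base (skew x) = odometer (base x).
Proof. by apply/funext => i; rewrite /base /skew odd_double doubleK. Qed.

Lemma scen_skew x s : scen (skew x) s = scen x (s ^^ jump (base x)).
Proof. by rewrite /scen /skew /= odd_double /= uphalf_double. Qed.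

Lemma base_iter n x : base (iter n skew x) = iter n odometer (base x).
Proof. by elim: n => //= n <-; rewrite base_skew. Qed.

(** One [false] among the digits from [3 * j] to [4 * j] absorbs all carries for
    [2 ^ (3 * j)] steps. *)
Definition carry_free j (y : nat -> bool) := has (fun i => ~~ y i) (iota (3 * j) j).

Definition walk j (y : nat -> bool) n :=
  active_code j.*2 (iter n odometer y) ^^ active_code j.*2 y.

Lemma walk_lt j y n : walk j y n < 2 ^ j.*2.
Proof. by apply: lxor_lt_pow2; exact: active_code_lt. Qed.

Lemma carry_free_low j y : carry_free j y ->
  low_value (4 * j) y + 2 ^ (3 * j) < 2 ^ (4 * j).
Proof.
move=> /hasP[i]; rewrite mem_iota => /andP[ji ij] yi.
have i4 : i < 4 * j by lia.
suff lt : low_value (4 * j) y + 2 ^ i < 2 ^ (4 * j).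
  by rewrite (leq_ltn_trans _ lt)// leq_add2l leq_exp2l.
rewrite -(subnK i4); elim: (_ - _) => [|k IH].
  rewrite add0n /= (negbTE yi) expnS; have := low_value_lt i y; lia.
rewrite addSn /= expnS; case: (y _); lia.
Qed.

(** The jumps telescope, because each of them is a coboundary. *)
Lemma scen_iter j x : carry_free j (base x) -> forall n, n <= 2 ^ (3 * j) ->
  forall s, scen (iter n skew x) s = scen x (s ^^ walk j (base x) n).
Proof.
move=> cf; elim=> [_ s|n IH nj s].
  by rewrite /walk /= Nat.lxor_nilpotent Nat.lxor_0_r.
rewrite iterS scen_skew IH; last exact: ltnW.
rewrite (@jumpE j.*2) base_iter -?iterS; last first.
  have : ~~ all (iter n odometer (base x)) (iota 0 (4 * j)).
    rewrite all_low_value low_value_iter.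
    have lo := carry_free_low cf; rewrite modn_small; lia.
  by rewrite -has_predC => /hasP[i]; rewrite mem_iota => ij yi; exists i => //; lia.
rewrite /walk -!lxorA; congr (scen x (_ ^^ (_ ^^ _))).
by rewrite lxorA Nat.lxor_nilpotent Nat.lxor_0_l.
Qed.

(** A time below [2 ^ (3 * j)] is determined by its [4 * j] low digits: the
    [j.*2] digits at odd positions are known from the position of the walk,
    which leaves [2 ^ j.*2] possibilities for the digits at even positions. *)
Lemma card_walk j y g L :
  #|[pred n : 'I_(2 ^ (3 * j)) | walk j y n ^^ g < L]| <= L * 2 ^ j.*2.
Proof.
case: L => [|L]; first by rewrite (eq_card0 (A:= [pred n : 'I__ | _])).
pose f (n : 'I_(2 ^ (3 * j))) : 'I_L.+1 * {ffun 'I_j.*2 -> bool} :=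
  (inord (walk j y n ^^ g), [ffun i : 'I__ => iter n odometer y i.*2]).
have -> : L.+1 * 2 ^ j.*2 = #|{: 'I_L.+1 * {ffun 'I_j.*2 -> bool}}|.
  by rewrite card_prod card_ord card_ffun card_bool card_ord.
apply: leq_trans (max_card (mem (f @: [pred n : 'I_(2 ^ (3 * j)) | walk j y n ^^ g < L.+1]))).
rewrite card_in_imset// => n n'; rewrite !inE => nL n'L [] /(congr1 (@nat_of_ord _)).
rewrite !inordK// => /lxorI; rewrite /walk => /lxorI /bits_code_inj odds evens.
have j34 : 2 ^ (3 * j) <= 2 ^ (4 * j) by rewrite leq_exp2l//; lia.
apply/val_inj/(@odometer_inj (4 * j) y); rewrite ?(leq_trans (ltn_ord _))// => i ij.
rewrite -(odd_double_half i); case: (odd i).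
  by rewrite add1n odds//; lia.
have i2 : i./2 < j.*2 by lia.
by move/ffunP/(_ (Ordinal i2)): evens; rewrite !ffunE.
Qed.

(** Each word of [m] digits is seen at most [2 ^ (3 * j - m)] times; the
    [2 ^ m] words share the [2 ^ (3 * j)] times, so all bounds are attained. *)
Lemma card_digits j m y (a : nat -> bool) : m <= 3 * j ->
  #|[pred n : 'I_(2 ^ (3 * j)) | all (fun i => iter n odometer y i == a i) (iota 0 m)]|
    = 2 ^ (3 * j - m).
Proof.
move=> mj.
pose M (w : {ffun 'I_m -> bool}) :=
  [pred n : 'I_(2 ^ (3 * j)) | [ffun i : 'I_m => iter n odometer y i] == w].
have leM w : #|M w| <= 2 ^ (3 * j - m).
  pose f (n : 'I_(2 ^ (3 * j))) : {ffun 'I_(3 * j - m) -> bool} :=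
    [ffun i : 'I__ => iter n odometer y (i + m)].
  have -> : 2 ^ (3 * j - m) = #|{ffun 'I_(3 * j - m) -> bool}|.
    by rewrite card_ffun card_bool card_ord.
  apply: leq_trans (max_card (mem (f @: M w))).
  rewrite card_in_imset// => n n'; rewrite !inE => /eqP nw /eqP; rewrite -{}nw => e1 e2.
  apply/val_inj/(@odometer_inj (3 * j) y); rewrite ?ltn_ord// => i ij.
  have [im|mi] := ltnP i m.
    by move/ffunP/(_ (Ordinal im)): e1; rewrite !ffunE.
  have i2 : i - m < 3 * j - m by lia.
  by move/ffunP/(_ (Ordinal i2)): e2; rewrite !ffunE /= subnK.
have sumM : \sum_w #|M w| = \sum_(w : {ffun 'I_m -> bool}) 2 ^ (3 * j - m).
  rewrite sum_nat_const card_ffun card_bool card_ord -expnD subnKC//.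
  transitivity #|'I_(2 ^ (3 * j))|; last by rewrite card_ord.
  under eq_bigr do rewrite -sum1_card.
  rewrite (exchange_big_dep xpredT)//= -sum1_card; apply: eq_bigr => n _.
  by rewrite (big_pred1 [ffun i : 'I_m => iter n odometer y i])// => w; rewrite inE eq_sym.
have eqM w : #|M w| = 2 ^ (3 * j - m).
  apply/eqP; move/eqP: sumM.
  by have := leqif_sum (fun w (_ : true) => leqif_eq (leM w)) => /leqifP; case: ifP => [/forallP/(_ w)//|_ /ltn_eqF ->].
rewrite -(eqM [ffun i : 'I_m => a i]); apply: eq_card => n; rewrite !inE.
apply/allP/eqP => [h|/ffunP h i].
  by apply/ffunP => i; rewrite !ffunE; apply/eqP/h; rewrite mem_iota /=.
rewrite mem_iota => im; have im' : i < m by lia.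
by have := h (Ordinal im'); rewrite !ffunE => /eqP.
Qed.

Lemma walk_agree j y y' n : (forall i, i < 4 * j -> y i = y' i) ->
  walk j y n = walk j y' n.
Proof.
move=> e; rewrite /walk /active_code; congr (_ ^^ _); apply: eq_bits_code => i ij.
  by apply: odometer_agree e _ _ _; lia.
by apply: e; lia.
Qed.

Lemma carry_free_agree j y y' : (forall i, i < 4 * j -> y i = y' i) ->
  carry_free j y = carry_free j y'.
Proof.
by move=> e; apply: eq_in_has => i; rewrite mem_iota => ij; rewrite e//; lia.
Qed.

(** The reason why the entropy vanishes: the walk sees at most [4 ^ j]
    sites in [8 ^ j] steps. *)
Lemma skew_agree j K x x' : K <= 4 * j -> carry_free j (base x) ->
  (forall i, i < 2 * 4 ^ j -> x i = x' i) ->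
  forall n, n <= 2 ^ (3 * j) -> forall i, i < K ->
  iter n skew x i = iter n skew x' i.
Proof.
move=> Kj cf e n nj i iK.
have j4 : 4 * j <= 4 ^ j.
  elim: (j) => // -[//|k] IH; rewrite expnS; lia.
have eb k : k < 4 * j -> base x k = base x' k.
  by move=> kj; apply: e; lia.
rewrite -(odd_double_half i); case: (odd i); last first.
  rewrite add0n -![iter n skew _ _]/(base (iter n skew _) _) !base_iter.
  by apply: odometer_agree eb _ _ _; lia.
rewrite add1n -![iter n skew _ _]/(scen (iter n skew _) _).
rewrite (scen_iter cf)// (@scen_iter j x') -?(carry_free_agree eb)//.
rewrite -(walk_agree _ eb); apply: e.
have : i./2 ^^ walk j (base x) n < 2 ^ j.*2.
  apply: lxor_lt_pow2; last exact: walk_lt.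
  rewrite -muln2 mulnC expnM -[2 ^ 2]/4; lia.
rewrite -muln2 mulnC expnM -[2 ^ 2]/4; lia.
Qed.

Import Order.TTheory GRing.Theory Num.Theory.
Import numFieldNormedType.Exports.

Local Open Scope classical_set_scope.
Local Open Scope ring_scope.

(** * The coin-tossing measure *)

Definition cyl n (w : nat -> bool) : set (nat -> bool) :=
  [set x | forall i, (i < n)%N -> x i = w i].

(** The phantom parameter is the field in which the distances are measured. *)
Definition bseq (R : realType) : Type := nat -> bool.

HB.instance Definition _ (R : realType) := Choice.on (bseq R).
HB.instance Definition _ (R : realType) := isPointed.Build (bseq R) (fun=> false).

Section bseq_metric.
Context {R : realType}.
Local Notation T := (bseq R).

(** The distance of two sequences is [i.+1^-1], for the first [i] where they
    differ. *)
Definition bseq_ball (x : T) (e : R) : set T :=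
  [set y | 0 < e /\ forall i, e <= i.+1%:R^-1 -> x i = y i].

HB.instance Definition _ := hasNbhs.Build T (nbhs_ (entourage_ bseq_ball)).

Let ball_center x (e : R) : 0 < e -> bseq_ball x e x. Proof. by []. Qed.

Let ball_sym x y (e : R) : bseq_ball x e y -> bseq_ball y e x.
Proof. by move=> [e0 h]; split=> // i /h. Qed.

Let ball_triangle x y z (e1 e2 : R) :
  bseq_ball x e1 y -> bseq_ball y e2 z -> bseq_ball x (e1 + e2) z.
Proof.
move=> [e10 h1] [e20 h2]; split=> [|i ei]; first exact: addr_gt0.
by rewrite h1 ?h2// (le_trans _ ei)// ?lerDl ?lerDr ltW.
Qed.

HB.instance Definition _ := @Nbhs_isPseudoMetric.Build R T
  (entourage_ bseq_ball) erefl bseq_ball ball_center ball_sym ball_triangle erefl.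

Lemma nbhs_cyl (x : T) (A : set T) : nbhs x A <-> exists n, cyl n x `<=` A.
Proof.
rewrite -(@nbhs_ballE R); split=> [[e /= e0 eA]|[n nA]].
  exists (Num.truncn e^-1) => y yx; apply: eA; split=> // i ei.
  rewrite yx// truncn_ge_nat ?invr_ge0 ?(ltW e0)//.
  by rewrite -div1r ler_pdivlMr// mulrC -ler_pdivlMr// div1r.
exists n.+1%:R^-1; first by rewrite /= invr_gt0.
move=> y [_ xy]; apply: nA => i ni; rewrite xy// lef_pV2 ?posrE//.
by rewrite ler_nat ltnW.
Qed.

Lemma nbhs_cylx n (x : T) : nbhs x (cyl n x).
Proof. by apply/nbhs_cyl; exists n. Qed.

Lemma open_cyl n (w : T) : open (cyl n w : set T).
Proof.
rewrite openE => x xw; apply/nbhs_cyl; exists n => y yx i ni.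
by rewrite yx// xw.
Qed.

Lemma bseq_hausdorff : hausdorff_space T.
Proof.
move=> p q pq; apply/funext => i.
have [z [zp zq]] := pq _ _ (nbhs_cylx i.+1 p) (nbhs_cylx i.+1 q).
by rewrite -zp ?zq.
Qed.

Lemma bseq_second_countable : @second_countable T.
Proof.
exists (range (fun s : seq bool => cyl (size s) (nth false s))).
  exact/(sub_countable (card_image_le _ _))/countableP.
split=> [_ [s _ <-]|x A /nbhs_cyl[n nA]]; first exact: open_cyl.
have xE i : (i < n)%N -> nth false (mkseq x n) i = x i by move=> ?; rewrite nth_mkseq.
exists (cyl (size (mkseq x n)) (nth false (mkseq x n))) => [|y /=].
  by split=> [|i]; [exists (mkseq x n)|rewrite size_mkseq => /xE].
by rewrite size_mkseq => yx; apply: nA => i ni; rewrite yx// xE.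
Qed.

Let bseq_cauchy_cvg (F : set_system T) : ProperFilter F -> cauchy F -> cvg F.
Proof.
move=> FF /(@cauchyP R) Fc.
have /choice[u Fu] i : exists x : T, F (ball x (i.+1%:R^-1 : R)).
  by apply: Fc; rewrite invr_gt0.
apply/cvg_ex; exists (fun i => u i i) => A /nbhs_cyl[n nA].
apply: filterS nA _; elim: n => [|n IH]; first exact: filterS filterT.
apply: filterS (filterI IH (Fu n)) => y [yu [_ un]] i.
by rewrite ltnS leq_eqVlt => /predU1P[->|/yu//]; rewrite un.
Qed.

HB.instance Definition _ := Uniform_isComplete.Build T bseq_cauchy_cvg.

Definition borel_bseq := g_sigma_algebraType (@open T).

Lemma measurable_cyl n w : measurable (cyl n w : set borel_bseq).
Proof. by apply: sub_sigma_algebra; exact: open_cyl. Qed.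

Definition cylinders : set (set T) := [set A | A = set0 \/ exists n w, A = cyl n w].

Lemma borel_bseqE : @measurable _ borel_bseq = <<s cylinders >>.
Proof.
apply/seteqP; split; last first.
  apply: smallest_sub; first exact: sigma_algebra_measurable.
  by move=> _ [->|[n [w ->]]]; [exact: measurable0|exact: measurable_cyl].
apply: smallest_sub; first exact: smallest_sigma_algebra.
move=> A oA.
pose G (s : seq bool) := if pselect (cyl (size s) (nth false s) `<=` A) then
  cyl (size s) (nth false s) else set0.
have -> : A = \bigcup_s G s.
  apply/seteqP; split=> [x Ax|x [s _]]; last by rewrite /G; case: pselect => // sA /sA.
  have /nbhs_cyl[n nA] : nbhs (x : T) A by exact: open_nbhs_nbhs.
  exists (mkseq x n) => //; rewrite /G.
  have e : cyl (size (mkseq x n)) (nth false (mkseq x n)) = cyl n x.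
    by rewrite size_mkseq; apply/seteqP; split=> y h i ni; rewrite h// nth_mkseq.
  by rewrite e; case: pselect.
apply: (@countable_bigcupT_measurable _ (g_sigma_algebraType cylinders)) => [|s].
  exact: countableP.
rewrite /G; case: pselect => p; last exact: measurable0.
by apply: sub_sigma_algebra; right; exists (size s), (nth false s).
Qed.

End bseq_metric.
Arguments borel_bseq R : clear implicits.

Section coin_measure.
Context {R : realType}.

(** The measure is the image of Lebesgue measure on the unit interval under the
    binary expansion. *)
Definition binary (x : R) : borel_bseq R :=
  fun i => odd (Num.truncn (x * 2 ^+ i.+1)).

Fixpoint prefix_code n (w : nat -> bool) : nat :=
  if n is m.+1 then (w m + (prefix_code m w).*2)%N else 0.

Lemma prefix_code_lt n w : (prefix_code n w < 2 ^ n)%N.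
Proof. by elim: n => //= n IH; rewrite expnS; case: (w n); lia. Qed.

Lemma truncn_half (x : R) n : 0 <= x ->
  Num.truncn (x * 2 ^+ n) = (Num.truncn (x * 2 ^+ n.+1))./2.
Proof.
move=> x0; apply: truncn_def.
have /truncn_itv : 0 <= x * 2 ^+ n.+1 by rewrite mulr_ge0 ?exprn_ge0.
set k := Num.truncn _ => /andP[kx xk].
have k2 : (k./2.*2 <= k)%N by rewrite -{2}(odd_double_half k) leq_addl.
have k3 : (k < k./2.+1.*2)%N.
  by rewrite -{1}(odd_double_half k) doubleS; case: (odd k); rewrite ?ltnS ?leqnSn.
have e : x * 2 ^+ n.+1 = x * 2 ^+ n * 2 by rewrite exprSr mulrA.
rewrite -(ler_pM2r (ltr0n R 2)) -(ltr_pM2r (ltr0n R 2)) -!natrM !muln2 -e.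
apply/andP; split; first by rewrite (le_trans _ kx)// ler_nat.
by rewrite (lt_le_trans xk)// ler_nat.
Qed.

Lemma cyl_binary (x : R) n w : 0 <= x < 1 ->
  cyl n w (binary x) <-> Num.truncn (x * 2 ^+ n) = prefix_code n w.
Proof.
move=> /andP[x0 x1]; elim: n => [|n IH].
  rewrite expr0 mulr1 /=; split=> // _; by apply: truncn_def; apply/andP.
have := truncn_half n x0; rewrite /= => e; split=> [h|h i].
  have /IH e2 : cyl n w (binary x) by move=> i ni; rewrite h// ltnW.
  by rewrite -(odd_double_half (Num.truncn _)) -e e2; congr (_ + _)%N; rewrite -h.
have {}e : Num.truncn (x * 2 ^+ n) = prefix_code n w.
  by rewrite e h half_bit_double.
rewrite ltnS leq_eqVlt => /predU1P[->|/(IH.2 e)//].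
by rewrite /binary h oddD odd_double addbF oddb.
Qed.

Let measurable_binary : measurable_fun setT binary.
Proof.
apply: (@measurability _ _ _ _ setT binary (@cylinders R) borel_bseqE).
move=> _ [_ [->|[n [w ->]]] <-]; rewrite setTI.
  by rewrite preimage_set0; exact: measurable0.
have -> : binary @^-1` cyl n w = \bigcap_(i in [set i | (i < n)%N])
    \bigcup_(m in [set m | odd m = w i]) [set x : R | Num.truncn (x * 2 ^+ i.+1) = m].
  apply/seteqP; split=> [x xw i /= ni|x h i ni].
    by exists (Num.truncn (x * 2 ^+ i.+1)) => //; exact: xw.
  by have [m /= <- <-] := h i ni.
have ge_ m i : measurable [set x : R | (m <= Num.truncn (x * 2 ^+ i))%N].
  case: m => [|m]; first by rewrite [X in measurable X](_ : _ = setT)//; apply/seteqP; split.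
  rewrite [X in measurable X](_ : _ = `[m.+1%:R / 2 ^+ i, +oo[%classic); first exact: measurable_itv.
  by apply/seteqP; split=> x /=; rewrite truncn_gt_nat in_itv/= andbT ler_pdivrMr ?exprn_gt0.
apply: bigcap_measurableType => i _.
apply: bigcup_measurable => m _.
rewrite [X in measurable X](_ : _ = [set x : R | (m <= Num.truncn (x * 2 ^+ i.+1))%N] `\`
    [set x : R | (m.+1 <= Num.truncn (x * 2 ^+ i.+1))%N]); first exact: measurableD.
apply/seteqP; split=> x /=; first by move=> ->; rewrite ltnn leqnn.
by move=> [a /negP]; rewrite -leqNgt => b; apply/eqP; rewrite eqn_leq b.
Qed.

Let unit_itv : set R := `[0, 1[%classic.
Let measurable_unit : measurable unit_itv. Proof. exact: measurable_itv. Qed.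

Definition coin : set (borel_bseq R) -> \bar R :=
  pushforward (mrestr lebesgue_measure measurable_unit) binary.

Let mcoin A : measurable A -> measurable (binary @^-1` A).
Proof. by move=> mA; rewrite -[X in measurable X]setTI; exact: measurable_binary. Qed.

Let coin0 : coin set0 = 0%E.
Proof. by rewrite /coin /pushforward preimage_set0 measure0. Qed.

Let coin_ge0 A : (0 <= coin A)%E. Proof. exact: measure_ge0. Qed.

Let coin_sigma_additive : semi_sigma_additive coin.
Proof.
move=> F mF tF mUF; rewrite /coin /pushforward preimage_bigcup.
apply: measure_semi_sigma_additive.
- by move=> n; exact: mcoin.
- apply/trivIsetP => /= i j _ _ ij; rewrite -preimage_setI.
  by move/trivIsetP : tF => /(_ _ _ _ _ ij) ->//; rewrite preimage_set0.
- by rewrite -preimage_bigcup; exact: mcoin.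
Qed.

HB.instance Definition _ := isMeasure.Build _ _ _ coin
  coin0 coin_ge0 coin_sigma_additive.

Lemma coin_cyl n w : coin (cyl n w) = ((2 ^+ n)^-1)%:E.
Proof.
have p0 : 0 < 2 ^+ n :> R by rewrite exprn_gt0.
rewrite /coin /pushforward /mrestr.
have -> : binary @^-1` cyl n w `&` unit_itv =
    `[(prefix_code n w)%:R / 2 ^+ n, (prefix_code n w).+1%:R / 2 ^+ n[%classic.
  apply/seteqP; split=> [x [xw]|x]; rewrite /unit_itv /= !in_itv /=.
    move=> x01; rewrite -((cyl_binary n w x01).1 xw); move: x01 => /andP[x0 x1].
    rewrite ler_pdivrMr// ltr_pdivlMr//; apply: truncn_itv.
    by rewrite mulr_ge0// ltW.
  rewrite ler_pdivrMr// ltr_pdivlMr// => xn.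
  have x01 : 0 <= x < 1.
    move: xn => /andP[a b]; rewrite -(pmulr_lge0 _ p0) (le_trans _ a)//=.
    rewrite -(ltr_pM2r p0) mul1r (lt_le_trans b)// -natrX ler_nat.
    exact: prefix_code_lt.
  by split=> //; apply/cyl_binary => //; exact: truncn_def.
rewrite lebesgue_measure_itv /= lte_fin ltr_pM2r ?invr_gt0// ltr_nat ltnSn.
by rewrite -EFinB -mulrBl -natrB// subSnn mul1r.
Qed.

Let coin_setT : coin setT = 1%E.
Proof.
rewrite (_ : setT = cyl 0 (fun=> false)) ?coin_cyl ?expr0 ?invr1//.
by apply/seteqP; split.
Qed.

HB.instance Definition _ := Measure_isProbability.Build _ _ _ coin coin_setT.

End coin_measure.
Arguments coin R : clear implicits.

Section coin_theory.
Context {R : realType}.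
Local Notation B := (borel_bseq R).
Local Notation coin := (coin R).

Lemma cylinders_setI : setI_closed (@cylinders R).
Proof.
move=> A C [->|[n [w ->]]] [->|[m [v ->]]]; rewrite ?set0I ?setI0; try by left.
have [->|/set0P[x [xw xv]]] := eqVneq (cyl n w `&` cyl m v) set0; first by left.
right; exists (maxn n m), x; apply/seteqP; split=> [y [yw yv] i|y yx].
  by rewrite leq_max => /orP[ni|mi]; [rewrite yw// xw|rewrite yv// xv].
split=> i ni; rewrite yx ?leq_max ?ni ?orbT//; first exact: xw.
exact: xv.
Qed.

Lemma measurable_bseq d (T : measurableType d) (f : T -> B) :
  (forall i, measurable [set x | f x i]) -> measurable_fun setT f.
Proof.
move=> mf; apply: (@measurability _ _ _ _ setT f (@cylinders R) borel_bseqE).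
move=> _ [_ [->|[n [w ->]]] <-]; rewrite setTI.
  by rewrite preimage_set0; exact: measurable0.
have -> : f @^-1` cyl n w = \bigcap_(i in [set i | (i < n)%N]) [set x | f x i = w i].
  by apply/seteqP; split=> x.
apply: bigcap_measurableType => i _; case: (w i); first exact: mf.
rewrite [X in measurable X](_ : _ = ~` [set x | f x i]); first exact: measurableC.
by apply/seteqP; split=> x /=; [move=> ->|move/negP/negbTE].
Qed.

Lemma measurable_coord i b : measurable ([set x | x i = b] : set B).
Proof.
apply: sub_sigma_algebra; rewrite /= openE => x xi.
by apply/nbhs_cyl; exists i.+1 => y yx /=; rewrite yx.
Qed.

(** The cylinders form a pi-system that generates the Borel sets. *)
Lemma coin_preserving (f : B -> B) : measurable_fun setT f ->
  (forall n w, coin (f @^-1` cyl n w) = ((2 ^+ n)^-1)%:E) ->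
  forall A, measurable A -> coin (f @^-1` A) = coin A.
Proof.
move=> mf fcyl A mA.
pose g : {mfun B >-> B} := HB.pack f (isMeasurableFun.Build _ _ _ _ f mf).
apply: (@measure_unique _ R B (@cylinders R) (fun=> setT) borel_bseqE
  cylinders_setI _ _ (distribution coin g) coin _ _ A mA) => //.
- by move=> _; right; exists 0%N, (fun=> false); apply/seteqP; split.
- by rewrite bigcup_const.
- move=> _ [->|[n [w ->]]]; first by rewrite !measure0.
  by rewrite [RHS]coin_cyl; exact: fcyl.
- by move=> _; exact: (le_lt_trans (probability_le1 _ measurableT) (ltry _)).
Qed.

Definition flip i0 : B -> B := fun x i => x i (+) (i == i0).

Lemma measurable_flip i0 : measurable_fun setT (flip i0).
Proof.
apply: measurable_bseq => i; rewrite /flip; case: (i == i0).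
  rewrite [X in measurable X](_ : _ = [set x | x i = false]); first exact: measurable_coord.
  by apply/seteqP; split=> x /=; rewrite addbT; case: (x i).
rewrite [X in measurable X](_ : _ = [set x | x i = true]); first exact: measurable_coord.
by apply/seteqP; split=> x /=; rewrite addbF.
Qed.

Lemma coin_flip i0 A : measurable A -> coin (flip i0 @^-1` A) = coin A.
Proof.
apply: coin_preserving => [|n w]; first exact: measurable_flip.
rewrite -(coin_cyl n (fun i => w i (+) (i == i0))); congr (coin _).
apply/seteqP; split=> x h i ni; rewrite /flip.
  by rewrite -(h i ni) /flip -addbA addbb addbF.
by rewrite (h i ni) -addbA addbb addbF.
Qed.

(** Each prescribed coordinate halves the measure, because flipping it
    exchanges the two halves. *)
Lemma coin_prescribe (J : eqType) (s : seq J) (p : J -> nat) (b : J -> bool) :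
  uniq (map p s) ->
  coin ([set x | forall j, j \in s -> x (p j) = b j] : set B) = ((2 ^+ size s)^-1)%:E /\
  measurable ([set x | forall j, j \in s -> x (p j) = b j] : set B).
Proof.
elim: s => [_|j s IH /= /andP[js us]].
  have -> : [set x : B | forall j, j \in [::] -> x (p j) = b j] = setT by apply/seteqP; split.
  by rewrite (@probability_setT _ _ _ coin) expr0 invr1; split.
pose A : set B := [set x | forall j, j \in s -> x (p j) = b j].
have [IHc IHm] : coin A = ((2 ^+ size s)^-1)%:E /\ measurable A := IH us.
have E c : [set x : B | forall i, i \in j :: s -> x (p i) = (if i == j then c else b i)] =
    A `&` [set x | x (p j) = c].
  apply/seteqP; split=> [x h|x [h xj] i]; last first.
    rewrite inE => /orP[/eqP ->|si]; first by rewrite eqxx.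
    by case: eqVneq => [->//|_]; exact: h.
  split=> [i si /=|]; last by rewrite /= h ?mem_head// eqxx.
  rewrite h ?inE ?si ?orbT//; case: eqVneq => // ij.
  by move: js; rewrite -ij map_f.
have mE c : measurable (A `&` [set x | x (p j) = c] : set B).
  by apply: measurableI => //; exact: measurable_coord.
have half : coin (A `&` [set x | x (p j) = ~~ b j]) = coin (A `&` [set x | x (p j) = b j]).
  rewrite -[LHS](coin_flip (p j))//; congr (coin _).
  have fA x : A (flip (p j) x) <-> A x.
    suff e i : i \in s -> flip (p j) x (p i) = x (p i).
      by split=> h i si; have := h i si; rewrite e.
    rewrite /flip => si; case: eqVneq => [pij|]; last by rewrite addbF.
    by move: js; rewrite -pij map_f.
  apply/seteqP; split=> x [/fA Ax]; rewrite /= /flip eqxx addbT.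
    by move/negb_inj.
  by move=> ->.
have sumE : coin A = (coin (A `&` [set x | x (p j) = b j]) + coin (A `&` [set x | x (p j) = b j]))%E.
  rewrite -{2}half -measureU//.
    congr (coin _); rewrite -setIUr; apply/seteqP; split=> [x Ax|x []//].
    by split=> //=; case: (x (p j)); case: (b j); auto.
  by apply/seteqP; split=> x // [[_ /= ->] [_ /=]]; case: (b j).
have -> : [set x : B | forall i, i \in j :: s -> x (p i) = b i] =
    A `&` [set x | x (p j) = b j].
  rewrite -E; apply/seteqP; split=> x h i si; rewrite h//; by case: eqVneq => [->|].
split=> //; move: sumE; rewrite IHc.
have : coin (A `&` [set x | x (p j) = b j]) \is a fin_num by rewrite fin_num_measure.
case: (coin _) => // r _ /eqP; rewrite -EFinD eqe => /eqP e; congr (_%:E).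
rewrite exprS invfM e -[r + r]mulr2n -(mulr_natl r) mulrA mulVf ?mul1r// pnatr_eq0.
Qed.

(** The skew product, on each set where the first [false] digit is fixed, and
    every twist of the scenery are of this form. *)
Definition signed_perm (p : nat -> nat) (b : nat -> bool) : B -> B :=
  fun x i => x (p i) (+) b i.

Lemma measurable_signed_perm p b : measurable_fun setT (signed_perm p b).
Proof.
apply: measurable_bseq => i.
rewrite [X in measurable X](_ : _ = [set x | x (p i) = ~~ b i]); first exact: measurable_coord.
by apply/seteqP; split=> x /=; rewrite /signed_perm; case: (x _); case: (b i).
Qed.

Lemma coin_signed_perm p b A : injective p -> measurable A ->
  coin (signed_perm p b @^-1` A) = coin A.
Proof.
move=> pI; apply: coin_preserving => [|n w]; first exact: measurable_signed_perm.
have [|c _] := @coin_prescribe _ (iota 0 n) p (fun i => w i (+) b i).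
  by rewrite map_inj_uniq ?iota_uniq.
rewrite -{2}(size_iota 0 n) -c; congr (coin _).
apply/seteqP; split=> x h i; rewrite /= /signed_perm ?mem_iota => ni.
  by rewrite -h// -addbA addbb addbF.
by rewrite h ?mem_iota// -addbA addbb addbF.
Qed.

End coin_theory.

(** * The completed coin-tossing space *)

Section completion.
Context {R : realType}.
Local Notation B := (borel_bseq R).

Definition coin_space := caratheodory_type ((coin R)^*)%mu.
Definition fair_coin : set coin_space -> \bar R :=
  @completed_measure_extension _ _ _ (coin R).

HB.instance Definition _ := Measure.on fair_coin.

Lemma measurable_borel (A : set B) : measurable A -> measurable (A : set coin_space).
Proof. exact: caratheodory_measurable_mu_ext. Qed.

Lemma fair_coin_borel (A : set B) : measurable A -> fair_coin A = coin R A.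
Proof. exact: measurable_mu_extE. Qed.

Let fair_coin_setT : fair_coin setT = 1%E.
Proof. by rewrite fair_coin_borel// (@probability_setT _ _ _ (coin R)). Qed.

HB.instance Definition _ := Measure_isProbability.Build _ _ _ fair_coin fair_coin_setT.

Lemma fair_coin_complete : measure_is_complete fair_coin.
Proof. exact: measure_is_complete_caratheodory. Qed.

(** The outer measure is an infimum over countable Borel covers, and the
    intersection of covers that are nearly optimal is optimal. *)
Lemma borel_hull (A : set coin_space) : measurable A ->
  exists V : set B, [/\ measurable V, A `<=` V & fair_coin (V `\` A) = 0%E].
Proof.
move=> mA.
have fA : fair_coin A \is a fin_num by rewrite fin_num_measure.
have /choice[F FP] n : exists F : (set B)^nat, @measurable_cover _ B A F /\
    (\sum_(k <oo) coin R (F k) < fair_coin A + n.+1%:R^-1%:E)%E.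
  have n0 : 0 < n.+1%:R^-1 :> R by rewrite invr_gt0.
  have [_ [F cF <-] Flt] := lb_ereal_inf_adherent n0 fA.
by exists F; split; [exact: cF|exact: Flt].
pose V : set B := \bigcap_n \bigcup_k F n k.
have mF n k : measurable (F n k) by have [[/(_ k)]] := FP n.
have mFU n : measurable (\bigcup_k F n k) by exact: bigcupT_measurable.
have mV : measurable V by exact: bigcap_measurableType.
have AV : A `<=` V by move=> x Ax n _; have [[_ AF] _] := FP n; exact: AF.
exists V; split=> //.
have mVX := measurable_borel mV.
have VA : (fair_coin V <= fair_coin A)%E.
  apply/lee_addgt0Pr => e e0.
  have [//|n ne] := @ltr_add_invr R 0 e _; rewrite add0r in ne.
  apply: le_trans (_ : coin R (\bigcup_k F n k) <= _)%E.
    rewrite fair_coin_borel// le_measure ?inE//.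
    by move=> x; exact.
  apply: le_trans (measure_sigma_subadditive (coin R) (mF n) (mFU n) _) _ => //.
  have [_ /ltW] := FP n; move=> /le_trans; apply.
  by rewrite leeD2l// lee_fin ltW.
have -> : fair_coin (V `\` A) = (fair_coin V - fair_coin A)%E.
  rewrite measureD//; last by rewrite -ge0_fin_numE ?measure_ge0// fin_num_measure.
  by rewrite setIidr.
apply/eqP; rewrite eq_le sube_le0 VA /= sube_ge0 ?fin_num_measure//.
by rewrite le_measure ?inE.
Qed.

Lemma borel_sandwich (A : set coin_space) : measurable A ->
  exists U V : set B, [/\ measurable U, measurable V, U `<=` A, A `<=` V
    & coin R (V `\` U) = 0%E].
Proof.
move=> mA; have [V [mV AV V0]] := borel_hull mA.
have [W [mW AW W0]] := borel_hull (measurableC mA).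
have mU : measurable (~` W) by exact: measurableC.
exists (~` W), V; split=> //; first by move=> x; apply: contra_notP => /AW.
have mD : measurable (V `\` ~` W) by exact: measurableD.
rewrite -fair_coin_borel//.
have -> : V `\` ~` W = (V `\` A) `|` (W `\` ~` A).
  apply/seteqP; split=> x; rewrite /setD /setU /setC /=.
    move=> [Vx /contrapT Wx]; have [Ax|Ax] := pselect (A x); last by left.
    by right; split=> // nAx; exact: nAx.
  move=> [[Vx nAx]|[Wx /contrapT Ax]]; split=> //.
  - by move=> nWx; apply: nWx; exact: AW.
  - exact: AV.
have mVX := measurable_borel mV; have mWX := measurable_borel mW.
apply/eqP; rewrite -measure_le0 (le_trans (measureU2 _ _ _))//.
- exact: measurableD.
- by apply: measurableD => //; exact: measurableC.
- have e : (fair_coin (V `\` A) + fair_coin (W `\` ~` A) = 0)%E by rewrite V0 W0 adde0.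
  by rewrite [leLHS]e.
Qed.

Lemma fair_coin_null (U A : set coin_space) (N : set B) :
  measurable U -> U `<=` A -> A `\` U `<=` N -> measurable N -> coin R N = 0%E ->
  measurable A /\ fair_coin A = fair_coin U.
Proof.
move=> mU UA AUN mN N0.
have neg : fair_coin.-negligible (A `\` U).
  exists N; split=> //; first exact: measurable_borel.
  by rewrite -N0; exact: fair_coin_borel.
have mAU : measurable (A `\` U : set coin_space) by exact: fair_coin_complete.
have -> : A = U `|` (A `\` U) by rewrite setDUK.
split; first exact: measurableU.
rewrite measureU//; last by rewrite setDE setICA setICr setI0.
have e : fair_coin (A `\` U) = 0%E := measure_negligible mAU neg.
by rewrite [X in (_ + X)%E]e adde0.
Qed.

Lemma fair_coin_preserving (f : B -> B) : measurable_fun setT f ->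
  (forall A, measurable A -> coin R (f @^-1` A) = coin R A) ->
  measure_preserving fair_coin (f : coin_space -> coin_space).
Proof.
move=> mf cf.
have mfA (A : set B) : measurable A -> measurable (f @^-1` A).
  by move=> mA; rewrite -[X in measurable X]setTI; exact: mf.
have sand (A : set coin_space) : measurable A ->
    measurable (f @^-1` A : set coin_space) /\ fair_coin (f @^-1` A) = fair_coin A.
  move=> mA; have [U [V [mU mV UA AV VU0]]] := borel_sandwich mA.
  have mVU : measurable (V `\` U) by exact: measurableD.
  have [|||||_ AU] := @fair_coin_null U A (V `\` U) => //.
  - exact: measurable_borel.
  - by move=> x [/AV Vx Ux].
  have [|||||mfA' fAU] := @fair_coin_null (f @^-1` U) (f @^-1` A) (f @^-1` (V `\` U)).
  - by apply: measurable_borel; exact: mfA.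
  - by move=> x; exact: UA.
  - by move=> x [/AV Vx Ux].
  - exact: mfA.
  - by rewrite cf.
  split=> //; rewrite fAU AU fair_coin_borel ?cf ?fair_coin_borel//.
  exact: mfA.
split=> [_ A mA|A mA]; last exact: (sand A mA).2.
by rewrite setTI; exact: (sand A mA).1.
Qed.

Lemma standard_fair_coin : standard_probability fair_coin.
Proof.
split; first exact: fair_coin_complete.
exists (bseq R), (coin R), setT, setT, idfun; split.
- by split; [exact: bseq_hausdorff|exact: bseq_second_countable].
- by split=> //; exact: probability_setT.
- by split=> //; exact: probability_setT.
- by split=> [x _|x y _ _|x _]//; exists x.
split=> A; last by move=> mA; rewrite setTI; exact: fair_coin_borel.
move=> _; rewrite setTI; split; first exact: borel_sandwich.
move=> [U [V [mU mV UA AV VU0]]].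
have [|||||//] := @fair_coin_null U A (V `\` U) => //.
- exact: measurable_borel.
- by move=> x [/AV Vx Ux].
- exact: measurableD.
Qed.

End completion.
Arguments fair_coin R : clear implicits.
Arguments coin_space R : clear implicits.

(** * Invariance of the measure under the skew product *)

Section skew_measure.
Context {R : realType}.
Local Notation B := (borel_bseq R).
Local Notation coin := (coin R).

(* On the set [first_false t] the skew product translates the sites by
   [shift_code t] and flips the first [t.+1] digits; its image is
   [first_true t]. *)
Let shift_code t := bits_code t.+1 (fun i => i.*2 < t)%N.

Let skew_perm t i := if odd i then (i./2 ^^ shift_code t).*2.+1 else i.
Let skew_sign t i := ~~ odd i && (i./2 <= t)%N.

Let skew_perm_inj t : injective (skew_perm t).
Proof.
move=> i j; rewrite /skew_perm; case: ifPn => oi; case: ifPn => oj.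
- move=> [] /double_inj /lxorI ij.
  by rewrite -(odd_double_half i) -(odd_double_half j) oi oj ij.
- by move=> e; move: oj; rewrite -e /= odd_double.
- by move=> e; move: oi; rewrite e /= odd_double.
- by [].
Qed.

Let first_false t : set B := [set x : B | (forall k, (k < t)%N -> x k.*2) /\ ~~ x t.*2].
Let first_true t : set B := [set x : B | (forall k, (k < t)%N -> ~~ x k.*2) /\ x t.*2].
Let all_true : set B := [set x : B | forall k, x k.*2].

Let skew_first t x : first_false t x -> skew x = signed_perm (skew_perm t) (skew_sign t) x.
Proof.
move=> [xt xnt]; apply/funext => i; rewrite /skew /signed_perm /skew_perm /skew_sign.
have -> : jump (base x) = shift_code t by exact: jump_first.
case: ifPn => oi /=; first by rewrite addbF.
rewrite /odometer /base; congr (_ (+) _).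
  by rewrite -{2}(odd_double_half i) (negbTE oi).
have [it|it] := leqP i./2 t.
  by apply/allP => k; rewrite mem_iota => ki; apply: xt; lia.
by apply/negP => /allP /(_ t); rewrite mem_iota (negbTE xnt) => /(_ _)/negP; apply; lia.
Qed.

Let signed_first t x : first_true t (signed_perm (skew_perm t) (skew_sign t) x) <-> first_false t x.
Proof.
rewrite /first_true /first_false /signed_perm /skew_perm /skew_sign /=.
split=> -[h1 h2]; split.
- by move=> k kt; have := h1 k kt; rewrite odd_double doubleK ltnW//= addbT negbK.
- by move: h2; rewrite odd_double doubleK leqnn /= addbT.
- by move=> k kt; have := h1 k kt; rewrite odd_double doubleK ltnW//= addbT negbK.
- by move: h2; rewrite odd_double doubleK leqnn /= addbT.
Qed.

Let measurable_first_false t : measurable (first_false t).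
Proof.
have -> : first_false t = \bigcap_(k in [set k | (k < t)%N]) [set x | x k.*2 = true] `&` [set x | x t.*2 = false].
  apply/seteqP; split=> x [h1 h2]; split=> //; first exact: negbTE.
  by apply/negP; rewrite /= in h2; rewrite h2.
apply: measurableI; last exact: measurable_coord.
by apply: bigcap_measurableType => k _; exact: measurable_coord.
Qed.

Let measurable_first_true t : measurable (first_true t).
Proof.
have -> : first_true t = \bigcap_(k in [set k | (k < t)%N]) [set x | x k.*2 = false] `&` [set x | x t.*2 = true].
  apply/seteqP; split=> x [h1 h2]; split=> // k /h1 /=; first by move/negbTE.
  by move=> ->.
apply: measurableI; last exact: measurable_coord.
by apply: bigcap_measurableType => k _; exact: measurable_coord.
Qed.

Let measurable_all_true : measurable all_true.
Proof.
have -> : all_true = \bigcap_k [set x | x k.*2 = true].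
  by apply/seteqP; split=> [x h k _|x h k]; [exact: h|exact: (h k)].
by apply: bigcap_measurableType => k _; exact: measurable_coord.
Qed.

Let all_true0 : coin all_true = 0%E.
Proof.
apply/eqP; rewrite eq_le measure_ge0 andbT; apply/lee_addgt0Pr => e e0.
rewrite add0e.
have [n ne] : exists n, (2 ^+ n)^-1 < e.
  have [//|n] := @ltr_add_invr R 0 e _; rewrite add0r => ne.
  exists n; apply: le_lt_trans ne; rewrite lef_pV2 ?posrE ?exprn_gt0//.
  by rewrite -natrX ler_nat ltn_expl.
have [|c m] := @coin_prescribe R _ (iota 0 n) double (fun=> true).
  by rewrite map_inj_uniq ?iota_uniq//; exact: double_inj.
rewrite size_iota in c; apply: le_trans (_ : (2 ^+ n)^-1%:E <= _)%E; last by rewrite lee_fin ltW.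
by rewrite -c le_measure ?inE// => x h k _; exact: h.
Qed.

Let skew_cover (x : B) : all_true x \/ exists t, first_false t x.
Proof.
have [h|/existsNP[k /negP xk]] := pselect (forall k, x k.*2); first by left.
right; have ex : exists k, ~~ x k.*2 by exists k.
by case: (ex_minnP ex) => t xt tmin; exists t; split=> // i; apply: contraLR => /tmin; rewrite -leqNgt.
Qed.

Let skew_pieces (A : set B) : skew @^-1` A =
  \bigcup_t (first_false t `&` signed_perm (skew_perm t) (skew_sign t) @^-1` A)
  `|` (all_true `&` signed_perm id (fun i => ~~ odd i) @^-1` A).
Proof.
have skew_true x : all_true x -> skew x = signed_perm id (fun i => ~~ odd i) x.
  move=> h; apply/funext => i; rewrite /skew jump_true// Nat.lxor_0_r /signed_perm.
  case: ifPn => oi /=.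
    by rewrite addbF /scen -{2}(odd_double_half i) oi.
  rewrite /odometer /base; congr (_ (+) _); last exact/allP.
  by rewrite -{2}(odd_double_half i) (negbTE oi).
apply/seteqP; split=> [x Ax|x [[t _ [xt Ax]]|[xT Ax]]].
- have [xT|[t xt]] := skew_cover x.
    by right; split=> //; rewrite /= -skew_true.
  by left; exists t => //; split=> //; rewrite /= -skew_first.
- by rewrite /= (skew_first xt).
- by rewrite /= skew_true.
Qed.

Let measurable_piece t (A : set B) : measurable A ->
  measurable (first_false t `&` signed_perm (skew_perm t) (skew_sign t) @^-1` A).
Proof.
move=> mA; apply: measurableI => //.
by rewrite -[X in measurable X]setTI; exact: measurable_signed_perm.
Qed.

Lemma measurable_skew : measurable_fun setT (skew : B -> B).
Proof.
move=> _ A mA; rewrite setTI skew_pieces; apply: measurableU.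
  by apply: bigcupT_measurable => t; exact: measurable_piece.
apply: measurableI => //.
by rewrite -[X in measurable X]setTI; exact: measurable_signed_perm.
Qed.

(** The pieces [first_false t] are mapped by signed permutations onto the
    pieces [first_true t], and both families exhaust the space up to null sets.
    An inequality is enough, because it also holds for complements. *)
Let coin_skew_le (A : set B) : measurable A -> (coin (skew @^-1` A) <= coin A)%E.
Proof.
move=> mA; rewrite skew_pieces.
have mU : measurable (\bigcup_t (first_false t `&` signed_perm (skew_perm t) (skew_sign t) @^-1` A)).
  by apply: bigcupT_measurable => t; exact: measurable_piece.
have mN : measurable (all_true `&` signed_perm id (fun i => ~~ odd i) @^-1` A).
  apply: measurableI => //.
  by rewrite -[X in measurable X]setTI; exact: measurable_signed_perm.
apply: le_trans (measureU2 _ mU mN) _.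
have zero : coin (all_true `&` signed_perm id (fun i => ~~ odd i) @^-1` A) = 0%E.
  by apply/eqP; rewrite -measure_le0 -all_true0 le_measure ?inE.
have pE t : first_false t `&` signed_perm (skew_perm t) (skew_sign t) @^-1` A =
    signed_perm (skew_perm t) (skew_sign t) @^-1` (first_true t `&` A).
  by apply/seteqP; split=> x [/signed_first].
have pcoin t : coin (first_false t `&` signed_perm (skew_perm t) (skew_sign t) @^-1` A) =
    coin (first_true t `&` A).
  by rewrite pE coin_signed_perm//; exact: measurableI.
have sumL := @measure_bigcup _ _ _ coin setT
  (fun t => first_false t `&` signed_perm (skew_perm t) (skew_sign t) @^-1` A).
have sumR := @measure_bigcup _ _ _ coin setT (fun t => first_true t `&` A).
suff le : (coin (\bigcup_t (first_false t `&` signed_perm (skew_perm t) (skew_sign t) @^-1` A))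
    <= coin A)%E by rewrite [X in (_ + X)%E]zero adde0; exact: le.
rewrite sumL; last 2 first.
- by move=> t _; exact: measurable_piece.
- move=> s t _ _ [x [[[s1 s2] _] [[t1 t2] _]]].
  case: (ltngtP s t) => // st; first by move: s2; rewrite t1.
  by move: t2; rewrite s1.
rewrite (eq_eseriesr (fun t _ => pcoin t)) -sumR.
- apply: le_measure; rewrite ?inE//.
    by apply: bigcupT_measurable => t; exact: measurableI.
  by move=> x [t _ []].
- by move=> t _; exact: measurableI.
- move=> s t _ _ [x [[[s1 s2] _] [[t1 t2] _]]].
  case: (ltngtP s t) => // st; first by move: s2; rewrite (negbTE (t1 _ st)).
  by move: t2; rewrite (negbTE (s1 _ st)).
Qed.

Lemma coin_skew (A : set B) : measurable A -> coin (skew @^-1` A) = coin A.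
Proof.
move=> mA; have mS : measurable (skew @^-1` A : set B).
  by rewrite -[X in measurable X]setTI; exact: measurable_skew.
apply/eqP; rewrite eq_le coin_skew_le//=.
have := coin_skew_le (measurableC mA); rewrite preimage_setC.
rewrite !probability_setC//.
by rewrite leeD2lE// leeN2.
Qed.

Lemma fair_coin_skew : measure_preserving (fair_coin R) (skew : coin_space R -> coin_space R).
Proof. exact: fair_coin_preserving measurable_skew coin_skew. Qed.

End skew_measure.

(** * Second moments of bounded random variables *)

Section bounded_mean.
Context d (X : measurableType d) (R : realType) (mu : probability X R).
Implicit Types (A D : set X) (f g : X -> R).

Definition prob A : R := fine (mu A).

Lemma probE A : measurable A -> mu A = (prob A)%:E.
Proof. by move=> mA; rewrite fineK// fin_num_measure. Qed.

Lemma prob_ge0 A : 0 <= prob A. Proof. by rewrite fine_ge0. Qed.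

Lemma prob_setT : prob setT = 1. Proof. by rewrite /prob probability_setT. Qed.

Lemma prob_set0 : prob set0 = 0. Proof. by rewrite /prob measure0. Qed.

Lemma le_prob A D : measurable A -> measurable D -> A `<=` D -> prob A <= prob D.
Proof. by move=> mA mD AD; rewrite -lee_fin -!probE// le_measure ?inE. Qed.

Lemma prob_le1 A : measurable A -> prob A <= 1.
Proof. by move=> mA; rewrite -prob_setT le_prob. Qed.

Lemma probU_le A D : measurable A -> measurable D -> prob (A `|` D) <= prob A + prob D.
Proof.
move=> mA mD; rewrite -lee_fin EFinD -!probE ?measureU2//; exact: measurableU.
Qed.

Definition bounded_rv f := measurable_fun setT f /\ exists M, forall x, `|f x| <= M.

Definition mean f : R := \int[mu]_x f x.

Lemma bounded_rv_integrable f : bounded_rv f -> mu.-integrable setT (EFin \o f).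
Proof.
move=> [mf [M fM]]; apply: measurable_bounded_integrable => //.
  by rewrite -ge0_fin_numE ?measure_ge0// fin_num_measure.
exists M; split; first exact: num_real.
by move=> x Mx y _; rewrite /= (le_trans (fM y))// ltW.
Qed.

Lemma bounded_rv_cst (c : R) : bounded_rv (fun=> c).
Proof. by split; [exact: measurable_cst|exists `|c|]. Qed.

Lemma bounded_rv_indic A : measurable A -> bounded_rv \1_A.
Proof.
move=> mA; split; first exact: measurable_indic.
by exists 1 => x; rewrite indicE; case: (_ \in _); rewrite ?normr1 ?normr0.
Qed.

Lemma bounded_rvD f g : bounded_rv f -> bounded_rv g -> bounded_rv (fun x => f x + g x).
Proof.
move=> [mf [M fM]] [mg [L gL]]; split; first exact: measurable_funD.
by exists (M + L) => x; rewrite (le_trans (ler_normD _ _))// lerD.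
Qed.

Lemma bounded_rvM f g : bounded_rv f -> bounded_rv g -> bounded_rv (fun x => f x * g x).
Proof.
move=> [mf [M fM]] [mg [L gL]]; split; first exact: measurable_funM.
by exists (M * L) => x; rewrite normrM ler_pM.
Qed.

Lemma bounded_rvZ (c : R) f : bounded_rv f -> bounded_rv (fun x => c * f x).
Proof. exact: bounded_rvM (bounded_rv_cst c). Qed.

Lemma bounded_rv_sum (I : Type) (s : seq I) (F : I -> X -> R) :
  (forall i, bounded_rv (F i)) -> bounded_rv (fun x => \sum_(i <- s) F i x).
Proof.
move=> bF; elim: s => [|i s IH].
  by rewrite (_ : (fun _ => _) = fun=> 0); [exact: bounded_rv_cst|apply/funext => x; rewrite big_nil].
rewrite (_ : (fun _ => _) = fun x => F i x + \sum_(j <- s) F j x).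
  exact: bounded_rvD.
by apply/funext => x; rewrite big_cons.
Qed.

Lemma mean_cst c : mean (fun=> c) = c.
Proof. by rewrite /mean Rintegral_cst// -[fine _]/(prob setT) prob_setT mulr1. Qed.

Lemma meanD f g : bounded_rv f -> bounded_rv g ->
  mean (fun x => f x + g x) = mean f + mean g.
Proof. by move=> bf bg; rewrite /mean RintegralD//; exact: bounded_rv_integrable. Qed.

Lemma meanZ c f : bounded_rv f -> mean (fun x => c * f x) = c * mean f.
Proof. by move=> bf; rewrite /mean RintegralZl//; exact: bounded_rv_integrable. Qed.

Lemma mean_sum (I : Type) (s : seq I) (F : I -> X -> R) :
  (forall i, bounded_rv (F i)) ->
  mean (fun x => \sum_(i <- s) F i x) = \sum_(i <- s) mean (F i).
Proof.
move=> bF; elim: s => [|i s IH].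
  rewrite big_nil (_ : (fun _ => _) = fun=> 0) ?mean_cst//.
  by apply/funext => x; rewrite big_nil.
rewrite big_cons -IH -meanD//; last exact: bounded_rv_sum.
by congr mean; apply/funext => x; rewrite big_cons.
Qed.

Lemma mean_indic A : measurable A -> mean \1_A = prob A.
Proof. by move=> mA; rewrite /mean /Rintegral integral_indic// setIT. Qed.

Lemma le_mean f g : bounded_rv f -> bounded_rv g -> (forall x, f x <= g x) ->
  mean f <= mean g.
Proof.
by move=> bf bg fg; apply: le_Rintegral => //; exact: bounded_rv_integrable.
Qed.

Lemma measurable_gt_rv c f : bounded_rv f -> measurable [set x | c < f x].
Proof.
move=> [mf _]; rewrite (_ : [set x | _] = f @^-1` `]c, +oo[).
  by rewrite -[X in measurable X]setTI; apply: mf => //; exact: measurable_itv.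
by apply/seteqP; split=> x /=; rewrite in_itv/= andbT.
Qed.

Lemma bounded_rv_norm f : bounded_rv f -> bounded_rv (fun x => `|f x|).
Proof.
move=> [mf [M fM]]; split; first exact: measurableT_comp.
by exists M => x; rewrite normr_id.
Qed.

Lemma markov_indic c f : 0 <= c -> bounded_rv f -> (forall x, 0 <= f x) ->
  c * prob [set x | c < f x] <= mean f.
Proof.
move=> c0 bf f0; have mA := measurable_gt_rv c bf.
rewrite -mean_indic// -meanZ; last exact: bounded_rv_indic.
apply: le_mean => // [|x]; first exact/bounded_rvZ/bounded_rv_indic.
rewrite indicE; case: (boolP (x \in _)); last by rewrite mulr0.
by rewrite inE /= mulr1 => /ltW.
Qed.

Lemma prob_le_sum (I : finType) (A : set X) (F : I -> set X) :
  measurable A -> (forall i, measurable (F i)) ->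
  (forall x, A x -> exists i, F i x) -> prob A <= \sum_i prob (F i).
Proof.
move=> mA mF AF; rewrite -mean_indic//; under eq_bigr do rewrite -mean_indic//.
have bF i : bounded_rv (\1_(F i) : X -> R) by exact: bounded_rv_indic.
rewrite -mean_sum//; apply: le_mean => [||x]; first exact: bounded_rv_indic.
  exact: bounded_rv_sum.
rewrite indicE; case: (boolP (x \in A)) => [|_]; last by rewrite sumr_ge0// => i _; rewrite indicE.
rewrite inE => /AF[i Fix]; rewrite (bigD1 i)//= {1}indicE mem_set// lerDl.
by rewrite sumr_ge0// => k _; rewrite indicE.
Qed.

(** Chebyshev's inequality on the event [A], under which the events [F n] have
    probability [p] and are uncorrelated in pairs, except that each of them has
    at most [L] partners with which its covariance is only known to be at most
    [a]. Working on [A] avoids conditional probabilities. *)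
Lemma chebyshev_events (N : nat) (M : pred 'I_N) (F : 'I_N -> set X) (A : set X)
    (p a c : R) (L : nat) (close : rel 'I_N) :
  measurable A -> (forall n, measurable (F n)) -> 0 <= c ->
  prob A = a -> (forall n, M n -> prob (A `&` F n) = p * a) ->
  (forall n m, M n -> M m -> ~~ close n m ->
     prob (A `&` (F n `&` F m)) = p ^+ 2 * a) ->
  (forall n, (#|[pred m | close n m]| <= L)%N) ->
  c ^+ 2 * prob (A `&` [set x | c < `|\sum_(n | M n) (\1_(F n) x - p)|]) <=
    N%:R * L%:R * a.
Proof.
move=> mA mF c0 PA PAF PAFF closeL.
pose f n x : R := \1_(F n) x - p.
have bF n : bounded_rv (\1_(F n) : X -> R) by exact: bounded_rv_indic.
have bA : bounded_rv (\1_A : X -> R) by exact: bounded_rv_indic.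
have bf n : bounded_rv (f n) by apply: bounded_rvD => //; exact: bounded_rv_cst.
have bS : bounded_rv (fun x => `|\sum_(n | M n) f n x|).
  apply: bounded_rv_norm.
  rewrite (_ : (fun x => _) = fun x => \sum_n (M n)%:R * f n x).
    by apply: bounded_rv_sum => n; exact: bounded_rvZ.
  by apply/funext => x; rewrite big_mkcond; apply: eq_bigr => n _; case: (M n); rewrite ?mul1r ?mul0r.
have mS := measurable_gt_rv c bS.
have bff n m : bounded_rv (fun x => (M n && M m)%:R * (\1_A x * (f n x * f m x))).
  by apply/bounded_rvZ/bounded_rvM => //; exact: bounded_rvM.
have covariance n m : M n -> M m ->
    mean (fun x => \1_A x * (f n x * f m x)) = prob (A `&` (F n `&` F m)) - p ^+ 2 * a.
  move=> Mn Mm.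
  have -> : (fun x => \1_A x * (f n x * f m x)) = (fun x => \1_(A `&` (F n `&` F m)) x +
      ((- p) * \1_(A `&` F n) x + ((- p) * \1_(A `&` F m) x + p ^+ 2 * \1_A x))).
    by apply/funext => x; rewrite /f !indicI /=; ring.
  have bI D E' : measurable D -> measurable E' -> bounded_rv (\1_(D `&` E') : X -> R).
    by move=> mD mE; apply: bounded_rv_indic; exact: measurableI.
  have mFF : measurable (F n `&` F m) by exact: measurableI.
  rewrite !meanD ?meanZ ?mean_indic//; do ?[exact: bI|exact: measurableI|
    by apply: bounded_rvZ; exact: bI|by exact: bounded_rvZ|
    by apply: bounded_rvD; apply: bounded_rvZ => //; exact: bI|
    by apply: bounded_rvD; [apply: bounded_rvZ; exact: bI|
       apply: bounded_rvD; apply: bounded_rvZ => //; exact: bI]].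
  by rewrite !PAF// PA; ring.
have a0 : 0 <= a by rewrite -PA prob_ge0.
have cov_le n m : M n -> M m ->
    mean (fun x => \1_A x * (f n x * f m x)) <= (close n m)%:R * a.
  move=> Mn Mm; rewrite covariance//; case: (boolP (close n m)) => cnm; last first.
    by rewrite PAFF// subrr mul0r.
  rewrite mul1r lerBlDr (@le_trans _ _ a)//; last by rewrite lerDl mulr_ge0// sqr_ge0.
  by rewrite -PA le_prob//; apply: measurableI => //; exact: measurableI.
have mAS : measurable (A `&` [set x | c < `|\sum_(n | M n) f n x|]) by exact: measurableI.
rewrite -mean_indic// -meanZ; last exact: bounded_rv_indic.
apply: (@le_trans _ _ (mean (fun x => \sum_n \sum_m (M n && M m)%:R * (\1_A x * (f n x * f m x))))).
  apply: le_mean => [||x].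
  - exact/bounded_rvZ/bounded_rv_indic.
  - by apply: bounded_rv_sum => n; exact: bounded_rv_sum.
  have -> : \sum_n \sum_m (M n && M m)%:R * (\1_A x * (f n x * f m x)) =
      \1_A x * (\sum_(n | M n) f n x) ^+ 2.
    rewrite expr2 big_distrlr big_distrr /= [RHS]big_mkcond; apply: eq_bigr => n _.
    case: (M n) => /=; last by rewrite big1// => m _; rewrite mul0r.
    rewrite big_distrr /= [RHS]big_mkcond; apply: eq_bigr => m _.
    by case: (M m); rewrite ?mul1r ?mul0r.
  rewrite indicI /= mulrCA !indicE; case: (x \in A); rewrite ?mul1r ?mul0r//.
  case: (boolP (x \in _)); rewrite ?mulr1 ?mulr0 ?sqr_ge0//.
  by rewrite inE /= -[leRHS]real_normK ?num_real// => /ltW cx; rewrite ler_pXn2r ?nnegrE.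
rewrite mean_sum => [|n]; last exact: bounded_rv_sum.
apply: (@le_trans _ _ (\sum_(n < N) L%:R * a)); last first.
  by rewrite sumr_const card_ord -mulrA [leRHS]mulr_natl.
apply: ler_sum => n _; rewrite mean_sum//.
apply: (@le_trans _ _ (\sum_m (close n m)%:R * a)).
  apply: ler_sum => m _; rewrite meanZ; last by apply: bounded_rvM => //; exact: bounded_rvM.
  case: (boolP (M n && M m)) => [/andP[Mn Mm]|_]; first by rewrite mul1r cov_le.
  by rewrite mul0r mulr_ge0.
rewrite -mulr_suml ler_wpM2r// -natr_sum ler_nat (leq_trans _ (closeL n))//.
by rewrite -sum1_card [leqRHS]big_mkcond /=.
Qed.

End bounded_mean.

(** * Approximation of measurable sets by a filtration *)

Section approximable.
Context d (X : measurableType d) (R : realType) (mu : probability X R).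
Local Notation prob := (prob mu).
(** The relation [E k] stands for equality up to precision [k]; it is the
    equality of [k] coordinates in one application, and membership in the same
    atom of the [k]-th partition in the other. *)
Variable E : nat -> X -> X -> Prop.
Hypothesis E_sym : forall k x y, E k x y -> E k y x.
Hypothesis E_dec : forall k l x y, (k <= l)%N -> E l x y -> E k x y.

Definition saturated (e : X -> X -> Prop) (U : set X) :=
  forall x y, e x y -> U x -> U y.

Definition approximable (A : set X) := measurable A /\
  forall eps : R, 0 < eps -> exists k U,
    [/\ measurable U, saturated (E k) U & prob (A `+` U) <= eps].

Lemma measurable_setY (A D : set X) : measurable A -> measurable D -> measurable (A `+` D).
Proof. by move=> mA mD; apply: measurableU; exact: measurableD. Qed.

Let saturated_le k l U : (k <= l)%N -> saturated (E k) U -> saturated (E l) U.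
Proof. by move=> kl h x y /(E_dec kl); exact: h. Qed.

Let approximableC A : approximable A -> approximable (~` A).
Proof.
move=> [mA hA]; split; first exact: measurableC.
move=> e /hA[k [U [mU sU AU]]]; exists k, (~` U); split; first exact: measurableC.
  by move=> x y xy nUx Uy; apply: nUx; apply: sU Uy; exact: E_sym.
apply: le_trans AU; apply: le_prob; [|exact: measurable_setY|].
  by apply: measurable_setY; exact: measurableC.
by move=> x [[nA /contrapT Ux]|[nU /contrapT Ax]]; [right|left].
Qed.

Lemma approximableU A D : approximable A -> approximable D -> approximable (A `|` D).
Proof.
move=> [mA hA] [mD hD]; split; first exact: measurableU.
move=> e e0; have e20 : 0 < e / 2 by rewrite divr_gt0.
have [k [U [mU sU AU]]] := hA _ e20; have [l [V [mV sV DV]]] := hD _ e20.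
exists (maxn k l), (U `|` V); split; first exact: measurableU.
  move=> x y xy [Ux|Vx].
    by left; exact: (saturated_le (leq_maxl k l) sU xy).
  by right; exact: (saturated_le (leq_maxr k l) sV xy).
rewrite (splitr e); apply: le_trans (lerD AU DV).
apply: le_trans (probU_le _ _ _); [|exact: measurable_setY..].
apply: le_prob; [|apply: measurableU; exact: measurable_setY|].
  by apply: measurable_setY; exact: measurableU.
by move=> x /=; tauto.
Qed.

Let approximable_approx (A : set X) : measurable A ->
  (forall eps : R, 0 < eps -> exists2 D, approximable D & prob (A `+` D) <= eps) ->
  approximable A.
Proof.
move=> mA h; split=> // e e0; have e20 : 0 < e / 2 by rewrite divr_gt0.
have [D [mD /(_ _ e20)[k [U [mU sU DU]]]] AD] := h _ e20.
exists k, U; split=> //; rewrite (splitr e); apply: le_trans (lerD AD DU).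
apply: le_trans (probU_le _ _ _); [|exact: measurable_setY..].
apply: le_prob; [exact: measurable_setY|apply: measurableU; exact: measurable_setY|].
by move=> x /=; have [?|?] := pselect (D x); tauto.
Qed.

Lemma approximable_negligible A : measurable A -> mu.-negligible A -> approximable A.
Proof.
move=> mA nA; split=> // e e0; exists 0%N, set0; split=> //.
rewrite /setY setD0 set0D setU0 /prob (measure_negligible mA nA) /=; exact: ltW.
Qed.

Lemma approximable_saturated k A : measurable A -> saturated (E k) A -> approximable A.
Proof.
move=> mA sA; split=> // e e0; exists k, A; split=> //.
rewrite (_ : A `+` A = set0) /prob ?measure0 /=; first exact: ltW.
by rewrite /setY setDv setU0.
Qed.

(** A countable union is close in measure to its finite subunions. *)
Lemma approximable_sigma_algebra : sigma_algebra setT approximable.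
Proof.
split.
- by apply: (@approximable_saturated 0%N) => //.
- by move=> A aA; rewrite setTD; exact: approximableC.
move=> A aA; have mA n : measurable (A n) by have [] := aA n.
have mU : measurable (\bigcup_n A n) by exact: bigcupT_measurable.
apply: approximable_approx => // e e0.
pose F n := \bigcup_(i < n) A i.
have aF n : approximable (F n).
  elim: n => [|n IH].
    rewrite /F bigcup_mkord big_ord0.
    exact: (@approximable_saturated 0%N).
  by rewrite /F bigcup_mkord big_ord_recr /= -bigcup_mkord; exact: approximableU.
have mF n : measurable (F n) by have [] := aF n.
have : mu ((\bigcup_n A n) `\` F n) @[n --> \oo] --> mu (\bigcap_n ((\bigcup_n A n) `\` F n)).
  apply: nonincreasing_cvg_mu => //.
  - by rewrite -ge0_fin_numE ?measure_ge0// fin_num_measure//; exact: measurableD.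
  - by move=> n; exact: measurableD.
  - by apply: bigcap_measurableType => n _; exact: measurableD.
  - move=> m n mn; apply/subsetPset => x [Ux nF]; split=> // -[i /= im Ai].
    by apply: nF; exists i => //=; rewrite (leq_trans im).
have -> : \bigcap_n ((\bigcup_n A n) `\` F n) = set0.
  apply/seteqP; split=> x // h; have [[n _ Anx] _] := h 0%N Logic.I.
  by have [_] := h n.+1 Logic.I; apply; exists n => /=.
rewrite measure0 => /fine_cvgP[_ /cvgrPdist_lt/(_ _ e0)[n _ /(_ n (leqnn n))]] /=.
rewrite sub0r normrN ger0_norm ?fine_ge0// => /ltW ne.
exists (F n) => //; apply: le_trans ne; apply: le_prob => //.
- exact: measurable_setY.
- exact: measurableD.
- by move=> x [//|[[i _ Ai] []]]; exists i.
Qed.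

(** The approximation in measure becomes a pointwise statement off a small
    exceptional set, whose visits along an orbit can be counted. *)
Lemma approximable_decided A : approximable A -> forall eps : R, 0 < eps ->
  exists k D, [/\ measurable D, prob D <= eps &
    forall x y, E k x y -> ~ D x -> ~ D y -> A x -> A y].
Proof.
move=> [mA hA] e /hA[k [U [mU sU AU]]]; exists k, (A `+` U); split=> //.
  exact: measurable_setY.
move=> x y xy nDx nDy Ax.
have Ux : U x by apply: contrapT => Ux; apply: nDx; left.
by apply: contrapT => Ay; apply: nDy; right; split=> //; exact: sU xy Ux.
Qed.

Lemma partition_decided (P : finite_partition X) :
  (forall A, measurable A -> approximable A) -> forall eps : R, 0 < eps ->
  exists k D, [/\ measurable D, prob D <= eps &
    forall x y, E k x y -> ~ D x -> ~ D y -> same_atom P x y].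
Proof.
move=> approx eps eps0.
have [cov _ _] := partition_atom P.
have n0 : (0 < natoms P)%N.
  have : cover [set: 'I_(natoms P)] P point by rewrite cov.
  by case=> i _ _; exact: leq_ltn_trans (leq0n i) (ltn_ord i).
have en0 : 0 < eps / (natoms P)%:R by rewrite divr_gt0// ltr0n.
have /choice[f /choice[D fD]] (i : 'I_(natoms P)) :=
  approximable_decided (approx _ (measurable_atom i)) en0.
have mD i : measurable (D i) by have [] := fD i.
have PD i : prob (D i) <= eps / (natoms P)%:R by have [] := fD i.
have mU : measurable (\bigcup_i D i) by apply: fin_bigcup_measurable => // i _; exact: mD.
exists (\max_i f i), (\bigcup_i D i); split=> //.
  apply: le_trans (prob_le_sum mu mU mD _) _ => [x [i _ Dx]|]; first by exists i.
  apply: le_trans (ler_sum _ (fun i _ => PD i)) _.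
  rewrite sumr_const card_ord -[_ *+ _]mulr_natr divfK// pnatr_eq0; lia.
move=> x y xy Dx Dy; have [i _ Pix] : cover [set: 'I_(natoms P)] P x by rewrite cov.
exists i; split=> //; have [_ _ h] := fD i; apply: h Pix.
- by apply: E_dec xy; exact: leq_bigmax.
- by apply: contra_not Dx => ?; exists i.
- by apply: contra_not Dy => ?; exists i.
Qed.

End approximable.

(** * Equidistribution in measure *)

Section birkhoff.
Context d (X : measurableType d) (R : realType) (mu : probability X R).
Variable T : X -> X.
Hypothesis T_mp : measure_preserving mu T.
Local Notation prob := (prob mu).

Definition birkhoff (N : nat) (D : set X) (x : X) : R :=
  N%:R^-1 * \sum_(n < N) \1_D (iter n T x).

Lemma iter_preserving n (D : set X) : measurable D ->
  measurable (iter n T @^-1` D) /\ prob (iter n T @^-1` D) = prob D.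
Proof.
move=> mD; elim: n => // n [mI pI].
have mS : measurable (T @^-1` (iter n T @^-1` D)).
  by rewrite -[X in measurable X]setTI; apply: T_mp.1.
have -> : iter n.+1 T @^-1` D = T @^-1` (iter n T @^-1` D).
  by apply/seteqP; split=> x /=; rewrite -iterSr.
by split=> //; rewrite -pI; congr fine; exact: T_mp.2.
Qed.

Let bounded_iter n D : measurable D -> bounded_rv (fun x => \1_D (iter n T x) : R).
Proof. by move=> /(iter_preserving n)[mI _]; exact: (bounded_rv_indic R mI). Qed.

Lemma bounded_birkhoff N D : measurable D -> bounded_rv (birkhoff N D).
Proof.
by move=> mD; apply: bounded_rvZ; apply: bounded_rv_sum => n; exact: bounded_iter.
Qed.

Lemma mean_birkhoff N D : (0 < N)%N -> measurable D -> mean mu (birkhoff N D) = prob D.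
Proof.
move=> N0 mD; rewrite /birkhoff meanZ; last by apply: bounded_rv_sum => n; exact: bounded_iter.
rewrite mean_sum => [|n]; last exact: bounded_iter.
under eq_bigr => n _.
  have [mI pI] := iter_preserving n mD.
  rewrite (_ : mean _ _ = prob D) //; last by rewrite -pI -(mean_indic mu mI).
  over.
by rewrite sumr_const card_ord -[prob D *+ N]mulr_natl mulKf// pnatr_eq0 -lt0n.
Qed.

Lemma birkhoff_ge0 N D x : 0 <= birkhoff N D x.
Proof. by rewrite mulr_ge0 ?invr_ge0// sumr_ge0// => n _; rewrite indicE. Qed.

Lemma markov_birkhoff N D c : (0 < N)%N -> measurable D -> 0 < c ->
  prob [set x | c < birkhoff N D x] <= prob D / c.
Proof.
move=> N0 mD c0; rewrite ler_pdivlMr// mulrC -(mean_birkhoff N0 mD).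
apply: markov_indic; [exact: ltW|exact: bounded_birkhoff|].
by move=> x; exact: birkhoff_ge0.
Qed.

Definition times j := (2 ^ (3 * j))%N.

Lemma times_gt0 j : (0 < times j)%N. Proof. by rewrite expn_gt0. Qed.

Definition deviation D (c : R) j := [set x | c < `|birkhoff (times j) D x - prob D|].

Lemma measurable_deviation D c j : measurable D -> measurable (deviation D c j).
Proof.
move=> mD; apply: (@measurable_gt_rv _ _ _ _ (fun x => `|birkhoff (times j) D x - prob D|)).
apply: bounded_rv_norm; apply: bounded_rvD; [exact: bounded_birkhoff|exact: bounded_rv_cst].
Qed.

(** Convergence along the times [8 ^ j] is what the estimates on the walk
    give, and is enough for ergodicity. *)
Definition equidistributed D := forall c e : R, 0 < c -> 0 < e ->
  exists J, forall j, (J <= j)%N -> prob (deviation D c j) <= e.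

Lemma equidistributed_sum (I : finType) (P : pred I) (F : I -> set X) D :
  measurable D -> (forall i, measurable (F i)) -> (forall i, equidistributed (F i)) ->
  (forall x, \1_D x = \sum_(i | P i) \1_(F i) x :> R) -> equidistributed D.
Proof.
move=> mD mF eF DF c e c0 e0.
pose q : R := #|I|.+1%:R.
have q0 : 0 < q by [].
have /choice[J JP] i := eF i _ _ (divr_gt0 c0 q0) (divr_gt0 e0 q0).
exists (\max_i J i) => j Jj.
have bD N x : birkhoff N D x = \sum_(i | P i) birkhoff N (F i) x.
  rewrite /birkhoff -mulr_sumr; congr (_ * _); rewrite exchange_big /=.
  by apply: eq_bigr => n _; rewrite DF.
have pD : prob D = \sum_(i | P i) prob (F i).
  rewrite -(mean_birkhoff (times_gt0 0) mD).
  rewrite (_ : birkhoff _ _ = fun x => \sum_(i <- [seq i <- index_enum I | P i]) birkhoff (times 0) (F i) x).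
    rewrite mean_sum => [|i]; last exact: bounded_birkhoff.
    by rewrite big_filter; apply: eq_bigr => i _; rewrite mean_birkhoff ?times_gt0.
  by apply/funext => x; rewrite bD big_filter.
have sub x : deviation D c j x -> exists i, deviation (F i) (c / q) j x.
  move=> /= dx; apply/not_existsP => h; move: dx; apply/negP; rewrite -leNgt bD pD -sumrB.
  apply: le_trans (ler_norm_sum _ _ _) _.
  apply: (@le_trans _ _ (\sum_(i : I) c / q)).
    rewrite big_mkcond; apply: ler_sum => i _; case: (P i); last by rewrite divr_ge0// ltW.
    by rewrite leNgt; apply/negP => /h.
  rewrite sumr_const -mulr_natr -mulrA ger_pMr// ler_pdivrMl// mulr1 ler_nat.
  by rewrite leqnSn.
apply: le_trans (prob_le_sum mu (measurable_deviation _ _ mD) (fun i => measurable_deviation (c / q) j (mF i)) sub) _.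
apply: (@le_trans _ _ (\sum_(i : I) e / q)).
  by apply: ler_sum => i _; apply: JP; rewrite (leq_trans _ Jj)//; exact: leq_bigmax.
rewrite sumr_const -mulr_natr -mulrA ger_pMr// ler_pdivrMl// mulr1 ler_nat.
by rewrite leqnSn.
Qed.

(** The averages of [D] and of [C] differ by at most the averages of their
    symmetric difference, which Markov's inequality controls. *)
Lemma equidistributed_approx D : measurable D ->
  (forall e : R, 0 < e -> exists C, [/\ measurable C, equidistributed C & prob (D `+` C) <= e]) ->
  equidistributed D.
Proof.
move=> mD h c e c0 e0.
have c30 : 0 < c / 3 by rewrite divr_gt0.
have e20 : 0 < e / 2 by rewrite divr_gt0.
pose b := Num.min (c / 3) (e / 2 * (c / 3)).
have b0 : 0 < b by rewrite lt_min c30 mulr_gt0.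
have [C [mC eC DC]] := h _ b0.
have [J JP] := eC _ _ c30 e20.
have mY : measurable (D `+` C) by exact: measurable_setY.
exists J => j Jj.
have ind x : `|\1_D x - \1_C x| <= \1_(D `+` C) x :> R.
  rewrite !indicE /setY in_setU !in_setD.
  by case: (x \in D); case: (x \in C); rewrite /= ?subrr ?subr0 ?sub0r ?normrN ?normr1 ?normr0.
have avg x : `|birkhoff (times j) D x - birkhoff (times j) C x| <= birkhoff (times j) (D `+` C) x.
  rewrite /birkhoff -mulrBr -sumrB normrM ger0_norm ?invr_ge0// ler_wpM2l ?invr_ge0//.
  by apply: le_trans (ler_norm_sum _ _ _) _; apply: ler_sum => n _; exact: ind.
have pDC : `|prob D - prob C| <= prob (D `+` C).
  have half A B : measurable A -> measurable B -> prob A <= prob B + prob (A `+` B).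
    move=> mA mB; have mAB := measurable_setY mA mB.
    apply: le_trans (probU_le _ mB mAB); apply: le_prob => //; first exact: measurableU.
    by move=> x Ax; have [Bx|Bx] := pselect (B x); [left|right; left].
  have DC1 := half _ _ mD mC; have := half _ _ mC mD.
  have -> : C `+` D = D `+` C by rewrite /setY setUC.
  by rewrite ler_norml => DC2; apply/andP; split; lra.
have sub : deviation D c j `<=` deviation C (c / 3) j `|` [set x | c / 3 < birkhoff (times j) (D `+` C) x].
  move=> x /= dx; have [lt|ge] := ltP (c / 3) (birkhoff (times j) (D `+` C) x); first by right.
  left; rewrite /deviation /=; have bc : b <= c / 3 by rewrite ge_min lexx.
  have -> : birkhoff (times j) C x - prob C = (birkhoff (times j) D x - prob D) -
     ((birkhoff (times j) D x - birkhoff (times j) C x) - (prob D - prob C)) by ring.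
  apply: lt_le_trans (lerB_normD _ _).
  rewrite normrN.
  have := le_trans (avg x) ge; have := le_trans pDC (le_trans DC bc).
  have := ler_normB (birkhoff (times j) D x - birkhoff (times j) C x) (prob D - prob C).
  by move: dx; rewrite /deviation /= => *; lra.
have mY3 : measurable [set x | c / 3 < birkhoff (times j) (D `+` C) x].
  exact/measurable_gt_rv/bounded_birkhoff.
have mC3 := measurable_deviation (c / 3) j mC.
apply: le_trans (le_prob _ _ _ sub) _; first exact: measurable_deviation.
  exact: measurableU.
apply: le_trans (probU_le mu mC3 mY3) _; rewrite (splitr e); apply: lerD; first exact: JP.
apply: le_trans (markov_birkhoff (times_gt0 j) mY c30) _.
by rewrite ler_pdivrMr// (le_trans DC)// ge_min lexx orbT.
Qed.

(** The averages of an invariant set are its indicator, which stays away from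
    its mean unless the mean is 0 or 1. *)
Lemma equidistributed_ergodic : (forall D, measurable D -> equidistributed D) ->
  ergodic mu T.
Proof.
move=> eqd A mA invA.
have birkA j x : birkhoff (times j) A x = \1_A x.
  have it n : \1_A (iter n T x) = \1_A x :> R.
    elim: n => // n <-; rewrite !indicE; congr (nat_of_bool _)%:R.
    have e y : A (T y) <-> A y by rewrite -{2}invA.
    by apply/idP/idP => /set_mem /e Ay; apply: mem_set.
  rewrite /birkhoff; under eq_bigr do rewrite it.
  rewrite sumr_const card_ord -[\1_A x *+ _]mulr_natl mulKf//.
  by rewrite pnatr_eq0 -lt0n times_gt0.
have [p0|p0] := eqVneq (prob A) 0; first by left; rewrite (probE mu mA) p0.
have [p1|p1] := eqVneq (prob A) 1; first by right; rewrite (probE mu mA) p1.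
have pgt0 : 0 < prob A by rewrite lt_def p0 prob_ge0.
have plt1 : prob A < 1 by rewrite lt_def eq_sym p1 prob_le1.
pose c := Num.min (prob A) (1 - prob A) / 2.
have m0 : 0 < Num.min (prob A) (1 - prob A) by rewrite lt_min pgt0 subr_gt0.
have c0 : 0 < c by rewrite divr_gt0.
have [J /(_ J (leqnn J))] := eqd _ mA c (1 / 2) c0 (divr_gt0 ltr01 (ltr0n _ 2)).
have -> : deviation A c J = setT.
  apply/seteqP; split=> // x _; rewrite /deviation /= birkA indicE.
  apply: (@lt_le_trans _ _ (Num.min (prob A) (1 - prob A))).
    by rewrite /c ltr_pdivrMr// ltr_pMr// ltr1n.
  case: (x \in A) => /=; first by rewrite ger0_norm ?ge_min ?lexx ?orbT// subr_ge0 ltW.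
  by rewrite sub0r normrN ger0_norm ?prob_ge0// ge_min lexx.
by rewrite prob_setT ler_pdivlMr// mul1r lern1.
Qed.

End birkhoff.

(** * Ergodicity of the skew product *)

Definition agree k (x y : nat -> bool) := forall i, (i < k)%N -> x i = y i.

Lemma agree_sym k x y : agree k x y -> agree k y x.
Proof. by move=> e i ik; rewrite e. Qed.

Lemma agree_le k l x y : (k <= l)%N -> agree l x y -> agree k x y.
Proof. by move=> kl e i ik; rewrite e// (leq_trans ik). Qed.

Section skew_ergodic.
Context {R : realType}.
Local Notation X := (coin_space R).
Local Notation mu := (fair_coin R).
Local Notation prob := (prob mu).
Local Notation T := (skew : X -> X).

Lemma coordinate_approximable (A : set X) : measurable A -> approximable mu agree A.
Proof.
have sg := approximable_sigma_algebra mu agree_sym agree_le.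
have cylA : (@cylinders R : set (set X)) `<=` approximable mu agree.
  move=> _ [->|[n [w ->]]]; first by case: sg.
  apply: (@approximable_saturated _ _ _ _ _ n).
    exact: (measurable_borel (@measurable_cyl R n w)).
  by move=> x y xy xw i ni; rewrite -xy// xw.
have borelA (U : set (borel_bseq R)) : measurable U -> approximable mu agree U.
  by rewrite borel_bseqE; exact: smallest_sub.
move=> mA; have [U [V [mU mV UA AV VU0]]] := borel_sandwich mA.
have mUX := measurable_borel mU.
have mAU : measurable (A `\` U : set X) by exact: measurableD.
have AE : A = (U : set X) `|` (A `\` U) by rewrite setDUK.
rewrite {}AE.
apply: (@approximableU _ X R mu agree agree_le); first exact: borelA.
apply: approximable_negligible => //; exists (V `\` U); split=> //.
- by apply: measurable_borel; exact: measurableD.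
- by rewrite -VU0; apply: fair_coin_borel; exact: measurableD.
- by move=> x [/AV].
Qed.

Lemma prob_prescribe (J : eqType) (s : seq J) (p : J -> nat) (b : J -> bool) :
  uniq (map p s) ->
  prob [set x | forall j, j \in s -> x (p j) = b j] = (2 ^+ size s)^-1 /\
  measurable ([set x | forall j, j \in s -> x (p j) = b j] : set X).
Proof.
move=> us; have [c m] := @coin_prescribe R _ s p b us.
split; last exact: measurable_borel.
have e := fair_coin_borel m; rewrite c in e.
by rewrite /prob [X in fine X]e.
Qed.

Lemma prob_prefix_sites k a (S : seq nat) (b : nat -> bool) : uniq S ->
  prob [set x | agree k (base x) a /\ forall s, s \in S -> scen x s = b s] =
    (2 ^+ (k + size S))^-1 /\
  measurable ([set x | agree k (base x) a /\ forall s, s \in S -> scen x s = b s] : set X).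
Proof.
move=> uS; pose s := map inl (iota 0 k) ++ map inr S : seq (nat + nat).
pose p (j : nat + nat) := match j with inl i => i.*2 | inr i => i.*2.+1 end.
pose v (j : nat + nat) := match j with inl i => a i | inr i => b i end.
have us : uniq (map p s).
  rewrite map_inj_uniq => [|[i|i] [j|j] /=]; last 4 first.
  - by move/double_inj => ->.
  - by move=> e; have := congr1 odd e; rewrite /= !odd_double.
  - by move=> e; have := congr1 odd e; rewrite /= !odd_double.
  - by move=> [] /double_inj ->.
  rewrite cat_uniq !map_inj_uniq ?iota_uniq ?uS//=; [|by move=> ? ? []..].
  rewrite andbT; apply/hasPn => _ /mapP[i _ ->]; apply/negP => /mapP[? _] //.
have -> : [set x | agree k (base x) a /\ forall s, s \in S -> scen x s = b s] =
    [set x | forall j, j \in s -> x (p j) = v j].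
  apply/seteqP; split=> x.
    move=> [h1 h2] j; rewrite mem_cat => /orP[] /mapP[i + ->] /=; last exact: h2.
    by rewrite mem_iota => ik; apply: h1.
  move=> h; split=> [i ik|i iS].
    by apply: (h (inl i)); rewrite mem_cat map_f// mem_iota.
  by apply: (h (inr i)); rewrite mem_cat map_f ?orbT.
by have := @prob_prescribe _ s p v us; rewrite size_cat !size_map size_iota.
Qed.

Lemma prob_carry j : prob [set x | ~~ carry_free j (base x)] = (2 ^+ j)^-1 /\
  measurable ([set x | ~~ carry_free j (base x)] : set X).
Proof.
have -> : [set x | ~~ carry_free j (base x)] =
    [set x | forall i, i \in iota (3 * j) j -> x i.*2 = true].
  apply/seteqP; split=> x /= h.
    by move=> i ij; apply/negPn; move: h; rewrite -all_predC => /allP; apply.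
  by rewrite -all_predC; apply/allP => i /h; rewrite /= /base => ->.
have := @prob_prescribe _ (iota (3 * j) j) double (fun=> true).
by rewrite size_iota; apply; rewrite map_inj_uniq ?iota_uniq//; exact: double_inj.
Qed.

Lemma cyl_decompose m w : cyl m.*2 w =
  [set x | agree m (base x) (base w) /\ forall s, s \in iota 0 m -> scen x s = scen w s].
Proof.
apply/seteqP; split=> x.
  by move=> h; split=> [i im|i]; [|rewrite mem_iota => im]; apply: h; lia.
move=> [h1 h2] i im; rewrite -(odd_double_half i); case: (odd i).
  by rewrite add1n; apply: h2; rewrite mem_iota; lia.
by rewrite add0n; apply: h1; lia.
Qed.

Definition extend K (a : {ffun 'I_K -> bool}) : nat -> bool :=
  fun i => if insub i is Some k then a k else false.

Lemma extend_restrict K y : agree K y (extend [ffun i : 'I_K => y i]).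
Proof. by move=> i iK; rewrite /extend insubT /= ffunE. Qed.

(** The visits of the orbit to a cylinder [cyl m.*2 w], on the set [A] where the
    first [4 * j] digits are those of [a]. These digits determine the walk and
    the digits of the orbit, so the times when the latter are right form a set
    [M] that does not depend on the point; at a time [n] in [M] the visit is the
    event [F n] that the scenery on the [window] around the walk is right. The
    windows are translates of the sites below [m = 2 ^ r], hence are equal or
    disjoint, and those of times that are not [close] are disjoint. *)
Section one_word.
Variables (r j : nat) (w a : nat -> bool).
Let m := (2 ^ r)%N.
Hypothesis mj : (m <= 3 * j)%N.
Hypothesis cf : carry_free j a.

Let A : set X := [set x | agree (4 * j) (base x) a].
Let close : rel 'I_(times j) := fun n n' => (walk j a n ^^ walk j a n' < m)%N.
Let window (n : 'I_(times j)) := [seq s ^^ walk j a n | s <- iota 0 m].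
Let F n : set X := [set x | forall s, s \in window n -> scen x s = scen w (s ^^ walk j a n)].
Let M : pred 'I_(times j) :=
  [pred n : 'I_(times j) | all (fun i => iter n odometer a i == base w i) (iota 0 m)].
Let p : R := (2 ^+ m)^-1.
Let e : R := (2 ^+ (4 * j))^-1.

Let uniq_window n : uniq (window n).
Proof. by rewrite map_inj_uniq ?iota_uniq//; exact: lxorI. Qed.

Let mem_window n s : (s \in window n) = (s ^^ walk j a n < m)%N.
Proof.
apply/mapP/idP => [[t + ->]|sm]; first by rewrite mem_iota lxorK.
by exists (s ^^ walk j a n); rewrite ?mem_iota// lxorK.
Qed.

Let A_E : A = [set x | agree (4 * j) (base x) a /\ forall s, s \in [::] -> scen x s = false].
Proof. by apply/seteqP; split=> [x Ax|x []]. Qed.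

Let F_E n : F n = [set x | agree 0 (base x) a /\ forall s, s \in window n -> scen x s = scen w (s ^^ walk j a n)].
Proof. by apply/seteqP; split=> [x Ax|x []]. Qed.

Let mA : measurable A.
Proof. by rewrite A_E; have [] := @prob_prefix_sites (4 * j) a [::] (fun=> false) erefl. Qed.

Let mF n : measurable (F n).
Proof. by rewrite F_E; have [] := @prob_prefix_sites 0 a (window n) (fun s => scen w (s ^^ walk j a n)) (uniq_window n). Qed.

Let prob_A : prob A = e.
Proof.
rewrite A_E; have [-> _] := @prob_prefix_sites (4 * j) a [::] (fun=> false) erefl.
by rewrite addn0.
Qed.

Let prob_AF n : prob (A `&` F n) = p * e.
Proof.
have [h _] := @prob_prefix_sites (4 * j) a (window n) (fun s => scen w (s ^^ walk j a n)) (uniq_window n).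
by rewrite /A /F -[LHS]/(prob [set x | _ /\ _]) h size_map size_iota exprD invfM mulrC.
Qed.

Let prob_AFF n n' : ~~ close n n' -> prob (A `&` (F n `&` F n')) = p ^+ 2 * e.
Proof.
move=> nc; have disj s : s \in window n -> s \in window n' -> False.
  rewrite !mem_window => sn sn'; move/negP: nc; apply; rewrite /close.
  by have := lxor_lt_pow2 sn sn'; rewrite lxorKK.
pose b s := if s \in window n then scen w (s ^^ walk j a n) else scen w (s ^^ walk j a n').
have uS : uniq (window n ++ window n').
  rewrite cat_uniq !uniq_window /= andbT; apply/hasPn => s sn'.
  by apply/negP => sn; exact: (disj s).
have [h _] := @prob_prefix_sites (4 * j) a _ b uS.
rewrite (_ : A `&` _ = [set x | agree (4 * j) (base x) a /\ forall s, s \in window n ++ window n' -> scen x s = b s]).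
  by rewrite h size_cat !size_map !size_iota (exprD _ (4 * j) (m + m)) (exprD _ m m) !invfM /e /p expr2 [LHS]mulrC.
apply/seteqP; split=> x [Ax].
  move=> [Fn Fn']; split=> // s; rewrite mem_cat /b.
  by case: ifPn => [sn _|_ /= sn']; [exact: Fn|exact: Fn'].
move=> h'; split=> //; split=> s sn; rewrite h' ?mem_cat ?sn ?orbT// /b ?sn//.
by case: ifPn => // sn'; case: (disj s).
Qed.

Let card_close n : (#|[pred n' | close n n']| <= m * 2 ^ j.*2)%N.
Proof.
apply: leq_trans (card_walk j a (walk j a n) m); apply: subset_leq_card.
by apply/fintype.subsetP => n'; rewrite !inE /close lxorC.
Qed.

Let card_M : #|M| = (2 ^ (3 * j - m))%N.
Proof. by rewrite -(@card_digits j m a (base w) mj). Qed.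

Let orbit_E x (n : 'I_(times j)) : A x ->
  \1_(cyl m.*2 w) (iter n T x) = (M n)%:R * \1_(F n) x :> R.
Proof.
move=> Ax; rewrite -natrM mulnb indicE; congr (nat_of_bool _)%:R.
have ea : forall i, (i < 4 * j)%N -> base x i = a i by [].
have cfx : carry_free j (base x) by rewrite (carry_free_agree ea).
have nj : (n <= 2 ^ (3 * j))%N := ltnW (ltn_ord n).
have sE s : scen (iter n T x) s = scen x (s ^^ walk j a n).
  by rewrite (scen_iter cfx nj) (walk_agree n ea).
have bE i : (i < m)%N -> base (iter n T x) i = iter n odometer a i.
  by move=> im; rewrite base_iter; apply: odometer_agree ea _ _ _; lia.
rewrite cyl_decompose; apply/idP/idP.
  move=> /set_mem[h1 h2]; apply/andP; split.
    apply/allP => i; rewrite mem_iota => im; rewrite -bE; last by lia.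
    by apply/eqP; apply: h1; lia.
  apply/mem_set => s; rewrite mem_window => sm.
  by rewrite -h2 ?mem_iota// sE lxorK.
move=> /andP[/allP h1 /set_mem h2]; apply/mem_set; split=> [i im|s].
  by rewrite bE//; apply/eqP/h1; rewrite mem_iota.
by rewrite mem_iota sE => sm; rewrite h2 ?mem_window lxorK.
Qed.

(** Among the [8 ^ j] times, each has at most [m * 4 ^ j] close ones. *)
Lemma deviation_word c : 0 < c ->
  prob (A `&` deviation mu T (cyl m.*2 w) c j) <= (2 ^+ r / 2 ^+ j / c ^+ 2) * (2 ^+ (4 * j))^-1.
Proof.
move=> c0; have mC : measurable (cyl m.*2 w : set X) := measurable_borel (@measurable_cyl R _ _).
have N0 : 0 < (times j)%:R :> R by rewrite ltr0n times_gt0.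
have prob_cyl : prob (cyl m.*2 w) = 2 ^- m * p.
  rewrite cyl_decompose; have [-> _] := @prob_prefix_sites m (base w) (iota 0 m) (scen w) (iota_uniq 0 m).
  by rewrite size_iota exprD invfM.
have dev x : A x -> birkhoff R T (times j) (cyl m.*2 w) x - prob (cyl m.*2 w) =
    (times j)%:R^-1 * \sum_(n | M n) (\1_(F n) x - p).
  move=> Ax; rewrite /birkhoff prob_cyl sumrB mulrBr; congr (_ - _).
    congr (_ * _); rewrite [RHS]big_mkcond; apply: eq_bigr => n _.
    by rewrite orbit_E//; case: (M n); rewrite ?mul1r ?mul0r.
  rewrite sumr_const card_M -[p *+ _]mulr_natl mulrA; congr (_ * _).
  rewrite /times !natrX -{1}(subnK mj) exprD invfM -mulrA [_ * 2 ^+ _]mulrC mulrA.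
  by rewrite mulVf ?mul1r// expf_neq0.
have NF : 0 <= (times j)%:R * c by rewrite mulr_ge0// ltW.
have := @chebyshev_events _ _ _ mu _ M F A p e _ _ close mA mF NF prob_A
  (fun n _ => prob_AF n) (fun n n' _ _ => @prob_AFF n n') card_close.
have -> : A `&` deviation mu T (cyl m.*2 w) c j =
    A `&` [set x | (times j)%:R * c < `|\sum_(n | M n) (\1_(F n) x - p)|].
  apply/seteqP; split=> x [Ax]; rewrite /deviation /= dev// => dx; split=> //.
    by move: dx; rewrite normrM ger0_norm ?invr_ge0// mulrC ltr_pdivlMr// mulrC.
  by rewrite /= normrM ger0_norm ?invr_ge0// mulrC ltr_pdivlMr// mulrC.
rewrite -ler_pdivlMl ?exprn_gt0 ?mulr_gt0//; move/le_trans; apply.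
rewrite /e mulrA ler_wpM2r ?invr_ge0 ?exprn_ge0//.
have -> : (m * 2 ^ j.*2)%:R = 2 ^+ r * 2 ^+ j.*2 :> R by rewrite natrM !natrX.
have -> : (times j)%:R = 2 ^+ j * 2 ^+ j.*2 :> R.
  by rewrite -exprD -natrX /times; congr (2 ^ _)%:R; lia.
rewrite le_eqVlt; apply/orP; left; apply/eqP; field.
by rewrite !expf_neq0 ?gt_eqF.
Qed.

End one_word.

(** The cases of all the words [a] of [4 * j] digits are summed; the digits
    that let a carry through have probability [2 ^ - j]. *)
Lemma equidistributed_cyl r w : equidistributed mu T (cyl (2 ^ r).*2 w).
Proof.
move=> c e c0 e0.
(* The total error will be [K / 2 ^ j]. *)
pose K := 2 ^+ r / c ^+ 2 + 1 : R.
have K0 : 0 < K by rewrite addr_gt0// divr_gt0 ?exprn_gt0.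
have [//|J] := @ltr_add_invr R 0 (e / K) _; first by rewrite divr_gt0.
rewrite add0r => Je; exists (maxn (2 ^ r) J) => j; rewrite geq_max => /andP[rj Jj].
have mC : measurable (cyl (2 ^ r).*2 w : set X) := measurable_borel (@measurable_cyl R _ _).
have mD := measurable_deviation (fair_coin_skew : measure_preserving mu T) c j mC.
have [pB mB] := prob_carry j.
pose A a : set X := [set x | agree (4 * j) (base x) a].
have mA a : measurable (A a).
  have [_] := @prob_prefix_sites (4 * j) a [::] (fun=> false) erefl.
  by rewrite (_ : [set x | _] = A a)//; apply/seteqP; split=> [x []|x Ax].
have mAD a : measurable (A a `&` deviation mu T (cyl (2 ^ r).*2 w) c j) by exact: measurableI.
pose F (a : {ffun 'I_(4 * j) -> bool}) : set X :=
  if carry_free j (extend a) then A (extend a) `&` deviation mu T (cyl (2 ^ r).*2 w) c j else set0.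
have mF a : measurable (F a) by rewrite /F; case: ifP.
set D := deviation _ _ _ _ _ in mD *.
have mDG : measurable (D `\` [set x | ~~ carry_free j (base x)]) by exact: measurableD.
apply: (@le_trans _ _ (prob (D `\` [set x | ~~ carry_free j (base x)]) + prob [set x | ~~ carry_free j (base x)])).
  apply: le_trans (probU_le mu mDG mB); apply: le_prob => //; first exact: measurableU.
  by move=> x Dx; have [?|?] := boolP (carry_free j (base x)); [left; split=> //; exact/negP/negPn|right].
have sub x : (D `\` [set x | ~~ carry_free j (base x)]) x -> exists a, F a x.
  move=> [Dx /= /negP/negPn cf]; pose a := [ffun i : 'I_(4 * j) => base x i].
  have ax : agree (4 * j) (base x) (extend a) := extend_restrict (base x).
  by exists a; rewrite /F -(carry_free_agree ax) cf.
apply: (@le_trans _ _ (\sum_(a : {ffun 'I_(4 * j) -> bool}) (2 ^+ r / 2 ^+ j / c ^+ 2) * (2 ^+ (4 * j))^-1 + (2 ^+ j)^-1)).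
  rewrite pB lerD2r; apply: le_trans (prob_le_sum mu mDG mF sub) _.
  apply: ler_sum => a _; rewrite /F; case: ifPn => cf; first by apply: deviation_word => //; lia.
  by rewrite prob_set0 mulr_ge0// ?invr_ge0 ?divr_ge0 ?exprn_ge0// ltW.
rewrite sumr_const card_ffun card_bool card_ord -[X in X + _]mulr_natl natrX mulrC divfK ?expf_neq0//.
have -> : 2 ^+ r / 2 ^+ j / c ^+ 2 + (2 ^+ j)^-1 = K / 2 ^+ j :> R.
  by rewrite /K; field; rewrite !expf_neq0 ?gt_eqF.
rewrite ler_pdivrMr ?exprn_gt0//.
have KJ : K < e * J.+1%:R by move: Je; rewrite ltr_pdivlMr// mulrC ltr_pdivrMr.
apply: le_trans (ltW KJ) _; rewrite ler_wpM2l ?(ltW e0)// -natrX ler_nat.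
exact: leq_ltn_trans Jj (ltn_expl j (ltnSn 1)).
Qed.

Lemma equidistributed_skew (D : set X) : measurable D -> equidistributed mu T D.
Proof.
move=> mD; have mp : measure_preserving mu T := fair_coin_skew.
apply: (equidistributed_approx mp mD) => e e0.
have [_ /(_ e e0)[k [U [mU sU DU]]]] := coordinate_approximable mD.
exists U; split=> //; set K := (2 ^ k).*2.
have kK : (k <= K)%N by have := ltn_expl k (ltnSn 1); rewrite /K; lia.
apply: (@equidistributed_sum _ _ _ mu T mp _ (fun a : {ffun 'I_K -> bool} => `[<U (extend a)>])
  (fun a => cyl K (extend a))) => //.
- by move=> a; exact: (measurable_borel (@measurable_cyl R _ _)).
- by move=> a; exact: equidistributed_cyl.
move=> x; pose a0 := [ffun i : 'I_K => x i].
have xa0 : agree K x (extend a0) := extend_restrict x.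
have UE : U x <-> U (extend a0).
  by split; apply: sU; [apply: agree_le kK _|apply/agree_sym/(agree_le kK)].
have cylE a : (x \in cyl K (extend a)) = (a == a0).
  apply/idP/eqP => [/set_mem h|->]; last exact: mem_set.
  by apply/ffunP => i; rewrite ffunE (h i (ltn_ord i)) /extend valK.
under eq_bigr do rewrite indicE cylE.
rewrite big_mkcond (bigD1 a0)//= eqxx big1 => [|a /negbTE ->]; last by case: ifP.
rewrite addr0 indicE; case: (boolP `[<U (extend a0)>]) => /asboolP Ua.
  by rewrite mem_set//; exact/UE.
by rewrite memNset// => /UE.
Qed.

Lemma ergodic_skew : ergodic mu T.
Proof. exact: (@equidistributed_ergodic _ X R mu T equidistributed_skew). Qed.

End skew_ergodic.

(** * Entropy bounds by coding *)

(** The inequality [ln x <= x - 1] for the ratios [q i / p i]. *)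
Lemma gibbs (R : realType) (I : finType) (p q : I -> R) :
  (forall i, 0 <= p i) -> (forall i, 0 < q i) -> \sum_i q i <= \sum_i p i ->
  - \sum_i p i * ln (p i) <= \sum_i p i * - ln (q i).
Proof.
move=> p0 q0 qp; rewrite -subr_ge0 opprK -big_split /=.
apply: (@le_trans _ _ (\sum_i (p i - q i))).
  by rewrite sumrB subr_ge0.
apply: ler_sum => i _; have := p0 i; rewrite le_eqVlt => /predU1P[<-|pi0].
  by rewrite !mul0r addr0 sub0r oppr_le0 ltW.
have : ln (q i / p i) <= q i / p i - 1.
  have := @le_ln1Dx R (q i / p i - 1); rewrite addrCA subrr addr0; apply.
  by rewrite ltrBrDl subrr divr_gt0.
rewrite ln_div ?posrE// => /(ler_wpM2l (ltW pi0)).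
rewrite mulrBr mulrBr mulr1 mulrCA divff ?gt_eqF// mulr1; lra.
Qed.

Section names.
Context d (X : measurableType d) (R : realType) (mu : probability X R).
Variable T : X -> X.
Hypothesis T_mp : measure_preserving mu T.
Variable P : finite_partition X.
Local Notation prob := (prob mu).

Lemma atom_unique i j x : P i x -> P j x -> i = j.
Proof. by move=> Pi Pj; have [_ + _] := partition_atom P; apply=> //; exists x. Qed.

Lemma atom_exists x : exists i, P i x.
Proof.
have [cov _ _] := partition_atom P.
have [i _ Pix] : cover [set: 'I_(natoms P)] P x by rewrite cov.
by exists i.
Qed.

Lemma natoms_gt0 : (0 < natoms P)%N.
Proof. by have [i _] := atom_exists point; exact: leq_ltn_trans (leq0n i) (ltn_ord i). Qed.

Definition atom_of x : 'I_(natoms P) := sval (cid (atom_exists x)).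

Lemma atom_ofP x : P (atom_of x) x.
Proof. exact: svalP (cid (atom_exists x)). Qed.

Definition name n x : {ffun 'I_n -> 'I_(natoms P)} := [ffun i : 'I_n => atom_of (iter i T x)].

Lemma cylinder_name n w x : cylinder T w x <-> w = name n x.
Proof.
split=> [h|-> i]; last by rewrite ffunE; exact: atom_ofP.
by apply/ffunP => i; rewrite ffunE; apply: atom_unique (h i) (atom_ofP _).
Qed.

Lemma measurable_cylinder n (w : {ffun 'I_n -> 'I_(natoms P)}) : measurable (cylinder T w).
Proof.
have -> : cylinder T w = \bigcap_(i in setT) (iter (i : 'I_n) T @^-1` P (w i)).
  by apply/seteqP; split=> [x h i _|x h i]; [exact: h|exact: (h i)].
apply: fin_bigcap_measurable => // i _.
by have [] := iter_preserving T_mp i (measurable_atom (w i)).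
Qed.

(** Gibbs' inequality, where [- ln (q w)] is understood as the length of the
    code word of the name [w]. *)
Lemma join_entropy_le n (q : {ffun 'I_n -> 'I_(natoms P)} -> R) (g : X -> R) :
  (forall w, 0 < q w) -> \sum_w q w <= 1 -> bounded_rv g ->
  (forall x, - ln (q (name n x)) <= g x) -> join_entropy mu T P n <= mean mu g.
Proof.
move=> q0 q1 bg qg.
have bc w : bounded_rv (\1_(cylinder T w) : X -> R) := bounded_rv_indic R (measurable_cylinder w).
have one (a : {ffun 'I_n -> 'I_(natoms P)} -> R) x : \sum_w a w * \1_(cylinder T w) x = a (name n x).
  rewrite (bigD1 (name n x))//= indicE mem_set ?mulr1 ?big1 ?addr0//; last exact/cylinder_name.
  by move=> w wx; rewrite indicE memNset ?mulr0// => /cylinder_name /eqP; apply/negP.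
have sum a : \sum_w prob (cylinder T w) * a w = mean mu (fun x => a (name n x)).
  under eq_bigr => w _ do rewrite -(mean_indic mu (measurable_cylinder w)) mulrC -meanZ//.
  rewrite -mean_sum; last by move=> w; exact: bounded_rvZ.
  by congr (mean _ _); apply/funext => x; rewrite one.
apply: le_trans (gibbs (fun w => prob_ge0 mu (cylinder T w)) q0 _) _.
  rewrite (le_trans q1)//; under eq_bigr do rewrite -[prob _]mulr1.
  by rewrite (sum (fun=> 1)) mean_cst.
rewrite (sum (fun w => - ln (q w))); apply: le_mean => //.
rewrite (_ : (fun x => - ln (q (name n x))) = fun x => \sum_w - ln (q w) * \1_(cylinder T w) x).
  by apply: bounded_rv_sum => w; exact: bounded_rvZ.
by apply/funext => x; rewrite (one (fun w => - ln (q w))).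
Qed.

Lemma join_entropy_ge0 n : 0 <= join_entropy mu T P n.
Proof.
rewrite /join_entropy -sumrN; apply: sumr_ge0 => w _; rewrite -mulrN.
rewrite mulr_ge0 ?fine_ge0// oppr_ge0 ln_le0//.
exact: (prob_le1 mu (measurable_cylinder w)).
Qed.

End names.

(** A code that serves all points at once. Half of the mass is spread evenly
    over all words, so that no word is longer than in the naive code, up to
    [ln 2]; the other half goes to words that are close, in Hamming distance, to
    one of the predictions [f v], for [v] in a small set [V]. *)
Section code.
Context (R : realType) (n : nat) (q : nat) (V : finType) (f : V -> 'I_n -> 'I_q).
Variable rho : R.
Hypothesis rho01 : 0 < rho < 1.
Hypothesis q0 : (0 < q)%N.
Hypothesis V0 : (0 < #|V|)%N.

Definition letter_weight (a b : 'I_q) : R := if a == b then rho else (1 - rho) / q%:R.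

Definition code_weight (w : {ffun 'I_n -> 'I_q}) : R :=
  2^-1 * (q%:R ^+ n)^-1 + 2^-1 * \sum_v #|V|%:R^-1 * \prod_i letter_weight (w i) (f v i).

Let q0R : 0 < q%:R :> R. Proof. by rewrite ltr0n. Qed.
Let V0R : 0 < #|V|%:R :> R. Proof. by rewrite ltr0n. Qed.

Lemma letter_weight_gt0 a b : 0 < letter_weight a b.
Proof.
by case/andP: rho01 => r0 r1; rewrite /letter_weight; case: ifP => // _; rewrite divr_gt0 ?subr_gt0.
Qed.

Let prod_gt0 (w : {ffun 'I_n -> 'I_q}) v : 0 < \prod_i letter_weight (w i) (f v i).
Proof. by apply: prodr_gt0 => i _; exact: letter_weight_gt0. Qed.

Let sum_ge0 (w : {ffun 'I_n -> 'I_q}) : 0 <= \sum_v #|V|%:R^-1 * \prod_i letter_weight (w i) (f v i).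
Proof. by apply: sumr_ge0 => v _; rewrite mulr_ge0 ?invr_ge0// ltW. Qed.

Lemma code_weight_gt0 w : 0 < code_weight w.
Proof.
by apply: ltr_pwDl; [rewrite mulr_gt0 ?invr_gt0 ?exprn_gt0|rewrite mulr_ge0 ?invr_ge0].
Qed.

Lemma sum_code_weight : \sum_w code_weight w <= 1.
Proof.
rewrite /code_weight big_split /= sumr_const card_ffun !card_ord -!mulr_sumr.
have h2 : (2^-1 : R) + 2^-1 = 1 by rewrite -div1r -splitr.
rewrite -[leRHS]h2; apply: lerD.
  by rewrite -mulrnAr -[X in _ * X]mulr_natl natrX divff ?mulr1// expf_neq0// gt_eqF.
rewrite -[leRHS]mulr1 ler_wpM2l ?invr_ge0// exchange_big /=.
rewrite (@le_trans _ _ (\sum_(v : V) #|V|%:R^-1))//; last first.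
  by rewrite sumr_const -[leLHS]mulr_natl divff// gt_eqF.
apply: ler_sum => v _; rewrite -mulr_sumr ger_pMr ?invr_gt0//.
rewrite -(bigA_distr_bigA (fun i a => letter_weight a (f v i))).
apply: prodr_ile1 => i _; rewrite sumr_ge0 /=; last by move=> a _; exact/ltW/letter_weight_gt0.
rewrite (bigD1 (f v i))//= /letter_weight eqxx.
rewrite (eq_bigr (fun=> (1 - rho) / q%:R)); last by move=> a /negbTE ->.
rewrite sumr_const -lerBrDl -[leLHS]mulr_natr -mulrA ger_pMr ?subr_gt0 ?(andP rho01).2//.
rewrite ler_pdivrMl// mulr1 ler_nat -[leqRHS]card_ord; exact: max_card.
Qed.

Lemma code_length_uniform w : - ln (code_weight w) <= ln 2 + n%:R * ln q%:R.
Proof.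
have qn0 : 0 < q%:R ^+ n :> R by rewrite exprn_gt0.
have -> : ln 2 + n%:R * ln q%:R = - ln (2^-1 * (q%:R ^+ n)^-1) :> R.
  by rewrite lnM ?posrE ?invr_gt0// !lnV ?posrE// opprD !opprK lnXn// mulr_natl.
rewrite lerN2 ler_ln ?posrE ?code_weight_gt0 ?mulr_gt0 ?invr_gt0//.
by rewrite /code_weight lerDl mulr_ge0 ?invr_ge0.
Qed.

Lemma code_length_prediction w v :
  - ln (code_weight w) <= ln 2 + ln #|V|%:R + \sum_i - ln (letter_weight (w i) (f v i)).
Proof.
have pos : 0 < 2^-1 * (#|V|%:R^-1 * \prod_i letter_weight (w i) (f v i)).
  by rewrite !mulr_gt0 ?invr_gt0.
apply: (@le_trans _ _ (- ln (2^-1 * (#|V|%:R^-1 * \prod_i letter_weight (w i) (f v i))))).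
  rewrite lerN2 ler_ln ?posrE ?code_weight_gt0//.
  apply: ler_wpDl; first by rewrite mulr_ge0 ?invr_ge0 ?exprn_ge0.
  rewrite ler_wpM2l ?invr_ge0// [leRHS](bigD1 v)//= lerDl sumr_ge0// => v' _.
  by rewrite mulr_ge0 ?invr_ge0// ltW.
rewrite !lnM ?posrE ?mulr_gt0 ?invr_gt0// !lnV ?posrE// !opprD !opprK addrA lerD2l.
rewrite sumrN lerN2.
suff [_ ->] : 0 < \prod_i letter_weight (w i) (f v i) /\
    ln (\prod_i letter_weight (w i) (f v i)) = \sum_i ln (letter_weight (w i) (f v i)) by [].
apply: (big_ind2 (fun x y => 0 < x /\ ln x = y)); first by rewrite ln1.
  by move=> x1 y1 x2 y2 [x10 <-] [x20 <-]; rewrite mulr_gt0// lnM ?posrE.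
by move=> i _; split=> //; exact: letter_weight_gt0.
Qed.

End code.

(** * Zero entropy *)

Section skew_entropy.
Context {R : realType}.
Local Notation X := (coin_space R).
Local Notation mu := (fair_coin R).
Local Notation prob := (prob mu).
Local Notation T := (skew : X -> X).
Variable P : finite_partition X.
Let q := natoms P.
Let T_mp : measure_preserving mu T := fair_coin_skew.

(** When [K] coordinates decide the atom off [D], guess the atom of any point
    off [D] that shares these coordinates. *)
Let prediction K (D : set X) :
  (forall x y, agree K x y -> ~ D x -> ~ D y -> same_atom P x y) ->
  exists f : X -> 'I_q, (forall x y, agree K x y -> f x = f y) /\
    forall x, ~ D x -> f x = atom_of P x.
Proof.
move=> dec; pose S y := [set a | exists x, [/\ agree K y x, ~ D x & a = atom_of P x]].
exists (fun y => xget (Ordinal (natoms_gt0 P)) (S y)); split=> [x y xy|x nDx].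
  congr xget; apply/seteqP; split=> a [z [xz nDz az]]; exists z; split=> // i iK.
    by rewrite -xy// xz.
  by rewrite xy// xz.
have : S x (xget (Ordinal (natoms_gt0 P)) (S x)).
  by apply: (@xgetPex _ _ (S x)); exists (atom_of P x), x.
move=> [z [xz nDz ->]]; have [a [ax az]] := dec _ _ xz nDx nDz.
by rewrite (atom_unique (atom_ofP P z) az) (atom_unique (atom_ofP P x) ax).
Qed.

(** If no carry occurs, the name is predicted by [2 * 4 ^ j.+1] initial bits,
    except at the times when the orbit visits [D]; if a carry occurs, the naive
    code is used, which costs [n * ln q] with probability [2 ^ - j.+1]. *)
Let join_entropy_small (eps : R) : 0 < eps -> exists J, forall n, (times J < n)%N ->
  join_entropy mu T P n / n%:R <= 3 * eps.
Proof.
(* A correct prediction costs [- ln rho = eps], a wrong one at most [L + eps];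
   [D] is so small that the wrong ones cost [eps] per letter on average. *)
move=> eps0; pose rho := expR (- eps).
have rho01 : 0 < rho < 1 by rewrite expR_gt0 -expR0 ltr_expR oppr_lt0.
have q0 := natoms_gt0 P.
pose L : R := `|ln ((1 - rho) / q%:R)|.
have Lge : - ln ((1 - rho) / q%:R) <= L by rewrite /L -normrN ler_norm.
have L0 : 0 <= L by rewrite normr_ge0.
have L1 : 0 < L + 1 by rewrite ltr_wpDl.
have [K [D [mD PD dec]]] := @partition_decided _ X R mu agree agree_le P
  coordinate_approximable _ (divr_gt0 eps0 L1).
have [F [Fagree FD]] := prediction dec.
have lnq0 : 0 <= ln q%:R :> R by rewrite ln_ge0// ler1n.
(* [C / 2 ^ j.+1] bounds, per letter, the cost [ln 2 + N * ln 2] of the initial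
   bits, since [8 ^ j < n], and that of the carries. *)
pose C : R := 24 + ln q%:R.
have C0 : 0 < C by rewrite ltr_pwDl.
have [//|J1] := @ltr_add_invr R 0 (eps / C) _; first exact: divr_gt0.
rewrite add0r => J1e; exists (maxn K J1) => n nJ.
have n0 : (0 < n)%N by rewrite (leq_ltn_trans _ nJ).
(* The smallest scale [j.+1] that covers the [n] times. *)
have [j [jn nj]] : exists j, (times j < n)%N /\ (n <= times j.+1)%N.
  have ex : exists j, (n <= times j)%N.
    exists n; rewrite /times ltnW// (leq_trans (ltn_expl n (ltnSn 1)))// leq_exp2l//.
    by rewrite leq_pmull.
  case: (ex_minnP ex) => -[|j] nj jmin.
    by move: nJ; rewrite ltnNge (leq_trans nj)// /times leq_exp2l// muln0.
  by exists j; split=> //; rewrite ltnNge; apply/negP => /jmin; rewrite ltnn.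
have Jj : (maxn K J1 <= j)%N.
  by have := leq_trans nJ nj; rewrite /times ltn_exp2l// ltn_pmul2l// ltnS.
move: Jj; rewrite geq_max => /andP[Kj J1j].
have Kj4 : (K <= 4 * j.+1)%N by rewrite mulnS (leq_trans Kj)//; lia.
pose N := (2 * 4 ^ j.+1)%N.
pose V := {ffun 'I_N -> bool}.
pose f (v : V) (i : 'I_n) : 'I_q := F (iter i T (extend v)).
have V0 : (0 < #|{: V}|)%N by rewrite card_ffun card_bool expn_gt0.
pose Q := code_weight f rho.
have [pB mB] := @prob_carry R j.+1.
have bD : bounded_rv (fun x : X => \sum_(i < n) \1_D (iter i T x) : R).
  apply: bounded_rv_sum => i; have [mI _] := iter_preserving T_mp i mD.
  exact: (bounded_rv_indic R mI).
have bB := bounded_rv_indic R mB.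
have bc := @bounded_rv_cst _ X R.
pose B : set X := [set x : X | ~~ carry_free j.+1 (base x)].
pose S (x : X) : R := \sum_(i < n) \1_D (iter i T x).
pose c0 : R := ln 2 + ln #|{: V}|%:R + n%:R * eps.
pose g (x : X) : R := c0 + L * S x + (n%:R * ln q%:R) * \1_B x.
have bgS := bounded_rvD (bc c0) (bounded_rvZ L bD).
have bgB := bounded_rvZ (n%:R * ln q%:R) bB.
have bg : bounded_rv g := bounded_rvD bgS bgB.
have ln20 : 0 <= ln 2 :> R by rewrite ln_ge0// ler1n.
have lnV0 : 0 <= ln #|{: V}|%:R :> R by rewrite ln_ge0// ler1n.
have length x : - ln (Q (name T P n x)) <= g x.
  rewrite /g indicE; case: (boolP (carry_free j.+1 (base x))) => cf; last first.
    rewrite mem_set// mulr1 (le_trans (code_length_uniform f rho01 q0 _))//.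
    have : 0 <= L * S x by rewrite mulr_ge0// sumr_ge0// => i _; rewrite indicE.
    have : 0 <= n%:R * eps by rewrite mulr_ge0// ltW.
    by rewrite /c0; lra.
  rewrite memNset ?mulr0 ?addr0; last by rewrite /B /= cf.
  pose v : V := [ffun i : 'I_N => x i].
  have xv : agree N x (extend v) := extend_restrict x.
  apply: le_trans (code_length_prediction f rho01 q0 V0 _ v) _.
  rewrite /c0 -!addrA lerD2l lerD2l /S.
  rewrite mulr_sumr (_ : n%:R * eps = \sum_(i < n) eps); last first.
    by rewrite sumr_const card_ord mulr_natl.
  rewrite -big_split /=; apply: ler_sum => i _; rewrite ffunE /letter_weight.
  have fE : f v i = F (iter i T x).
    apply: Fagree; apply: agree_sym => k kK.
    exact: (skew_agree Kj4 cf xv (leq_trans (ltnW (ltn_ord i)) nj) kK).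
  rewrite indicE; case: (boolP (_ \in D)) => [_|/negP iD].
    have eL : - ln rho = eps by rewrite /rho expRK opprK.
    case: ifP => _; first by rewrite eL mulr1 lerDl.
    by rewrite mulr1 (@le_trans _ _ L)// lerDr ltW.
  rewrite fE FD; last by move=> Dx; apply: iD; exact: mem_set.
  by rewrite eqxx mulr0 addr0 /rho expRK opprK.
have := join_entropy_le T_mp (code_weight_gt0 f rho01 q0) (sum_code_weight f rho01 q0 V0) bg length.
have -> : mean mu g = ln 2 + N%:R * ln 2 + n%:R * eps + L * (n%:R * prob D) +
    (n%:R * ln q%:R) * (2 ^+ j.+1)^-1.
  rewrite /g (meanD mu bgS bgB) (meanD mu (bc c0) (bounded_rvZ L bD)) mean_cst.
  rewrite (meanZ mu L bD) (meanZ mu _ bB) (mean_indic mu mB) pB.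
  congr (_ + _ + _ + L * _ + _).
    by rewrite card_ffun card_bool card_ord natrX lnXn// mulr_natl.
  rewrite mean_sum => [|i]; last by have [mI _] := iter_preserving T_mp i mD; exact: (bounded_rv_indic R mI).
  under eq_bigr => i _.
    have [mI pI] := iter_preserving T_mp i mD.
    rewrite (_ : mean _ _ = prob D); last by rewrite -pI -(mean_indic mu mI).
    over.
  by rewrite sumr_const card_ord mulr_natl.
have nR0 : 0 < n%:R :> R by rewrite ltr0n.
move=> H; rewrite ler_pdivrMr//; apply: le_trans H _.
have LD : L * prob D <= eps.
  rewrite (@le_trans _ _ (L * (eps / (L + 1))))// ?ler_wpM2l//.
  by rewrite mulrCA ger_pMr// ler_pdivrMr// mul1r lerDl.
have N24 : ln 2 + N%:R * ln 2 <= n%:R * (24 / 2 ^+ j.+1) :> R.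
  have ln21 : ln 2 <= 1 :> R by have := @le_ln1Dx R 1; apply; rewrite (lt_trans _ ltr01)// ltrN10.
  apply: le_trans (lerD ln21 (ler_piMr (ler0n R N) ln21)) _.
  rewrite mulrA ler_pdivlMr ?exprn_gt0// -natrX -natrM -(natrD _ 1) -!natrM ler_nat.
  have n8 : (8 ^ j <= n)%N by move: jn; rewrite /times expnM => /ltnW.
  have e8 : (4 ^ j * 2 ^ j = 8 ^ j)%N by rewrite -expnMn.
  have b8 : (2 ^ j <= 8 ^ j)%N by rewrite -e8 leq_pmull ?expn_gt0.
  rewrite /N !expnS mulnDl mul1n.
  have -> : (2 * (4 * 4 ^ j) * (2 * 2 ^ j) = 16 * (4 ^ j * 2 ^ j))%N by ring.
  have arith b c m : (b <= c -> c <= m -> 2 * b + 16 * c <= m * 24)%N by clear; lia.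
  by rewrite e8; exact: arith.
have Ce : C / 2 ^+ j.+1 <= eps.
  rewrite ler_pdivrMr ?exprn_gt0//.
  have CJ : C < eps * J1.+1%:R by move: J1e; rewrite ltr_pdivlMr// mulrC ltr_pdivrMr.
  apply: le_trans (ltW CJ) _; rewrite ler_wpM2l ?(ltW eps0)// -natrX ler_nat.
  by rewrite (leq_trans _ (ltn_expl j.+1 (ltnSn 1)))// ltnS ltnW.
have h1 := ler_wpM2l (ltW nR0) Ce; have h2 := ler_wpM2l (ltW nR0) LD.
rewrite [L * _]mulrCA -[_ * ln _ / _]mulrA.
move: h1; rewrite /C mulrDl mulrDr => h1.
move: N24 h1 h2; move: (ln 2 + _) (n%:R * (24 / _)) (n%:R * (ln _ / _)) (n%:R * (L * _)).
by move=> a b u v au bu vn; clear -au bu vn; rewrite (_ : 3 * eps * _ = n%:R * eps + n%:R * eps + n%:R * eps); [lra|ring].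
Qed.

Lemma partition_entropy_skew : partition_entropy mu T P = 0%E.
Proof.
apply/cvg_lim => //; apply: cvg_EFin; first exact: nearW.
apply/cvgrPdist_le => /= e e0.
have [J HJ] := join_entropy_small (divr_gt0 e0 (ltr0n R 3)).
exists (times J).+1 => // n /= Jn.
rewrite sub0r normrN ger0_norm ?divr_ge0 ?join_entropy_ge0//.
by apply: le_trans (HJ n Jn) _; rewrite mulrC divfK.
Qed.

End skew_entropy.

Lemma KS_entropy_skew (R : realType) : KS_entropy (fair_coin R) (skew : coin_space R -> coin_space R) = 0%E.
Proof.
rewrite /KS_entropy (_ : range _ = [set 0%E]) ?ereal_sup1//.
apply/seteqP; split=> [_ [P _ <-]|_ ->]; first exact: partition_entropy_skew.
have part : partition [set: 'I_1] (fun=> setT : set (coin_space R)) setT.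
  split=> [|i j _ _ _|i _]; last by exists point.
    by rewrite /cover bigcup_const//; exists ord0.
  by rewrite !ord1.
by exists (@FinitePartition _ _ 1 _ (fun=> measurableT) part) => //; exact: partition_entropy_skew.
Qed.

(** * Sequences of given upper density *)

Section enumeration.
Variable E : nat -> Prop.
Hypothesis E_inf : forall M, exists n, (M < n)%N && `[<E n>].

Definition next_after M := ex_minn (E_inf M).

Lemma next_afterP M : [/\ (M < next_after M)%N, E (next_after M) &
  forall n, (M < n)%N -> E n -> (next_after M <= n)%N].
Proof.
rewrite /next_after; case: ex_minnP => n /andP[Mn /asboolP En] nmin; split=> // k Mk Ek.
by apply: nmin; rewrite Mk; exact/asboolP.
Qed.

Fixpoint enumerate i := if i is k.+1 then next_after (enumerate k) else next_after 0.

Lemma enumerate_gt i : (i < enumerate i)%N.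
Proof.
elim: i => [|i IH] /=; first by have [] := next_afterP 0.
by have [+ _ _] := next_afterP (enumerate i); apply: leq_ltn_trans.
Qed.

Lemma enumerate_increasing : increasing_pos_seq enumerate.
Proof.
split=> [i|]; first exact: leq_ltn_trans (leq0n i) (enumerate_gt i).
by apply: homo_ltn => [|i]; [exact: ltn_trans|have [] := next_afterP (enumerate i)].
Qed.

Lemma enumerateP i : E (enumerate i).
Proof. by case: i => [|i] /=; [have [] := next_afterP 0|have [] := next_afterP (enumerate i)]. Qed.

Lemma enumerate_surj n : (0 < n)%N -> E n -> exists i, enumerate i = n.
Proof.
move=> n0 En; have start : (enumerate 0 <= n)%N.
  by have [_ _] := next_afterP 0; apply.
suff loop k i : (n - enumerate i <= k)%N -> (enumerate i <= n)%N -> exists i, enumerate i = n.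
  exact: loop start.
elim: k i => [|k IH] i ink; rewrite leq_eqVlt => /predU1P[|lt]; try by exists i.
  by exfalso; lia.
have [gt _ min] := next_afterP (enumerate i).
by apply: (IH i.+1) => /=; [have := min n lt En; lia|exact: min].
Qed.

End enumeration.

Section upper_density.
Context {R : realType}.

Lemma upper_density_le1 (m : nat -> nat) : (upper_density R m <= 1)%E.
Proof.
rewrite /upper_density limn_esup_lim; apply: lime_le; first exact: is_cvg_esups.
apply: nearW => n; apply: ge_ereal_sup => _ [N _ <-].
rewrite lee_fin; have [->|N0] := posnP N; first by rewrite invr0 mulr0.
by rewrite ler_pdivrMr ?ltr0n// mul1r ler_nat -[leqRHS]card_ord max_card.
Qed.

(** The increasing enumeration of [E] skips no element, so it has as many terms
    up to [N] as [E] has elements. *)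
Lemma upper_density_enumerate (E : nat -> Prop) (c : R) : 0 < c ->
  (forall e : R, 0 < e -> forall M, exists N, (M <= N)%N /\
    (c - e) * N%:R <= #|[pred n : 'I_N.+1 | (0 < n)%N && `[<E n>]]|%:R) ->
  exists m, [/\ increasing_pos_seq m, forall i, E (m i) & (c%:E <= upper_density R m)%E].
Proof.
move=> c0 dens.
have E_inf M : exists n, (M < n)%N && `[<E n>].
  apply: contrapT => h; have c20 : 0 < c / 2 by rewrite divr_gt0.
  have [N [NM Nc]] := dens _ c20 (Num.truncn (M%:R / (c / 2))).+1.
  move: Nc; apply/negP; rewrite -ltNge {1}(splitr c) addrK.
  apply: (@le_lt_trans _ _ M%:R); last first.
    rewrite -ltr_pdivrMl// mulrC (lt_le_trans (truncnS_gt _))// ler_nat.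
    exact: NM.
  rewrite ler_nat; pose f (n : 'I_N.+1) : nat := n.-1.
  rewrite cardE -(size_map f) -[leqRHS](size_iota 0); apply: uniq_leq_size.
    rewrite map_inj_in_uniq ?enum_uniq// => a b; rewrite !mem_enum !inE /f => /andP[a0 _] /andP[b0 _].
    by move=> ab; apply: val_inj => /=; lia.
  move=> _ /mapP[n + ->]; rewrite mem_enum inE mem_iota /f => /andP[n0 nE].
  have [nM|nM] := leqP n M; first by lia.
  by exfalso; apply: h; exists n; rewrite nM.
exists (enumerate E_inf); split; [exact: enumerate_increasing|exact: enumerateP|].
rewrite /upper_density limn_esup_lim; apply: lime_ge; first exact: is_cvg_esups.
apply: nearW => n; apply/lee_subgt0Pr => e e0.
have [N [nN Nc]] := dens e e0 n.+1.
apply: (@le_trans _ _ (#|[pred i : 'I_N | (enumerate E_inf i <= N)%N]|%:R / N%:R)%:E); last first.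
  by apply: ereal_sup_ubound; exists N => //=; exact: ltnW.
have N0 : (0 < N)%N by exact: leq_ltn_trans (leq0n n) nN.
rewrite -EFinB lee_fin ler_pdivlMr ?ltr0n// (le_trans Nc)// ler_nat.
have /choice[f fP] (k : 'I_N.+1) : exists i : 'I_N, (0 < k)%N && `[<E k>] -> enumerate E_inf i = k.
  have [/andP[k0 /asboolP Ek]|nk] := boolP ((0 < k)%N && `[<E k>]); last first.
    by exists (Ordinal N0).
  have [i ik] := enumerate_surj E_inf k0 Ek.
  have iN : (i < N)%N by have := enumerate_gt E_inf i; have := ltn_ord k; rewrite ik; lia.
  by exists (Ordinal iN).
rewrite -(card_in_imset (f := f)); last first.
  by move=> a b; rewrite !inE => ha hb ab; apply: val_inj; rewrite /= -(fP _ ha) -(fP _ hb) ab.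
apply: subset_leq_card; apply/fintype.subsetP => i /imsetP[k + ->].
by rewrite !inE => hk; rewrite fP// -ltnS.
Qed.

End upper_density.

(** * Uncountably many good parameters *)

Section fubini.
Context {R : realType}.
Local Notation B := (borel_bseq R).
Local Notation coin := (coin R).

Lemma coin_countable (S : set B) : countable S -> coin.-negligible S.
Proof.
have point w : coin.-negligible [set w].
  exists (\bigcap_n cyl n w); split=> [||x -> n _ //].
    by apply: bigcap_measurableType => n _; exact: measurable_cyl.
  apply/eqP; rewrite eq_le measure_ge0 andbT; apply/lee_addgt0Pr => e e0.
  rewrite add0e; have [//|n] := @ltr_add_invr R 0 e _; rewrite add0r => ne.
  apply: (@le_trans _ _ (coin (cyl n w))).
    rewrite le_measure ?inE//; last by move=> x; exact.
      by apply: bigcap_measurableType => k _; exact: measurable_cyl.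
    exact: measurable_cyl.
  rewrite coin_cyl lee_fin (le_trans _ (ltW ne))// lef_pV2 ?posrE ?exprn_gt0//.
  by rewrite -natrX ler_nat ltn_expl.
move=> /countable_injP[f finj].
have -> : S = \bigcup_n (S `&` f @^-1` [set n]).
  by apply/seteqP; split=> [x Sx|x [n _ []//]]; exists (f x).
apply: negligible_bigcup => n.
have [->|/set0P[w [Sw fw]]] := eqVneq (S `&` f @^-1` [set n]) set0.
  exact: negligible_set0.
apply: negligibleS (point w) => x [Sx fx]; apply: finj; rewrite ?inE//.
by rewrite fx fw.
Qed.

(** By Fubini's theorem, for almost every [x] the point [f (w, x)] avoids [V] for
    almost every [w]; a set of parameters of full measure is uncountable, since
    points are null. *)
Lemma uncountable_avoiding (f : B * B -> B) (V : set B) : measurable_fun setT f ->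
  (forall w A, measurable A -> coin ((fun x => f (w, x)) @^-1` A) = coin A) ->
  measurable V -> coin V = 0%E ->
  exists x, ~ countable [set w | ~ V (f (w, x))].
Proof.
move=> mf fpres mV V0.
have mW : measurable (f @^-1` V) by rewrite -[X in measurable X]setTI; exact: mf.
have := @indic_fubini_tonelli _ _ B B R coin coin _ mW.
rewrite (indic_fubini_tonelli_FE coin mW) (indic_fubini_tonelli_GE coin mW).
rewrite [X in X = _]integral0_eq => [/esym int0|w _]; last first.
  rewrite /= -[RHS]V0 -(fpres w V mV); congr (coin _).
  by apply/seteqP; split=> x; rewrite /xsection /= inE.
apply: contrapT => /forallNP h.
have mY := measurable_fun_ysection coin mW.
have : ae_eq coin setT (coin \o ysection (f @^-1` V)) (cst 0%E).
  apply/(ae_eq_integral_abs coin measurableT mY); rewrite -int0.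
  by apply: eq_integral => x _; rewrite gee0_abs.
move=> [N [mN N0 sub]].
have : coin setT = 0%E.
  apply/eqP; rewrite -measure_le0 -N0 le_measure ?inE// => x _; apply: sub => /=.
  move=> /(_ Logic.I) x0; have /contrapT/coin_countable[M [mM M0 subM]] := h x.
  have mx : measurable (ysection (f @^-1` V) x) by exact: measurable_ysection.
  have : (coin setT <= coin (M `|` ysection (f @^-1` V) x))%E.
    rewrite le_measure ?inE//; first exact: measurableU.
    move=> w _; have [Vw|Vw] := pselect (V (f (w, x))); last by left; apply: subM.
    by right; rewrite /ysection /= inE.
  rewrite leNgt => /negP; apply.
  rewrite (le_lt_trans (measureU2 _ mM mx))// [X in (X + _)%E]M0 add0e [ltLHS]x0.
  by rewrite (@probability_setT _ _ _ coin) lte01.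
by rewrite (@probability_setT _ _ _ coin) => /eqP; rewrite onee_eq0.
Qed.

End fubini.

(** * Refining sequences and exceptional sets *)

Section refining_sequence.
Context d (X : measurableType d) (R : realType) (mu : probability X R).
Variable P : nat -> finite_partition X.
Hypothesis mu_complete : measure_is_complete mu.
Hypothesis P_refining : refining mu P.

Lemma same_atom_sym (Q : finite_partition X) x y : same_atom Q x y -> same_atom Q y x.
Proof. by move=> [i [ix iy]]; exists i. Qed.

Lemma same_atom_refine k l x y : (k <= l)%N -> same_atom (P l) x y -> same_atom (P k) x y.
Proof.
move=> kl; rewrite -(subnK kl); elim: (l - k)%N => // n IH [j [jx jy]].
have [i ji] := P_refining.1 (n + k)%N j.
by apply: IH; exists i; split; exact: ji.
Qed.

(** The sets approximated by unions of atoms form a sigma-algebra, which contains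
    the atoms and, by completeness, the null sets. *)
Lemma refining_approximable A : measurable A ->
  approximable mu (fun k => same_atom (P k)) A.
Proof.
have sg := @approximable_sigma_algebra _ X R mu (fun k => same_atom (P k))
  (fun k => @same_atom_sym (P k)) same_atom_refine.
have : <<s (\bigcup_k range (P k)) `|` mu.-negligible >> `<=` approximable mu (fun k => same_atom (P k)).
  apply: smallest_sub => // D [[k _ [i _ <-]]|nD].
    apply: (@approximable_saturated _ _ _ _ _ k); first exact: measurable_atom.
    move=> x y [j [jx jy]] ix.
    have [_ /(_ i j Logic.I Logic.I) + _] := partition_atom (P k).
    by move=> ->//; exists x.
  by apply: approximable_negligible => //; exact: mu_complete.
by rewrite -P_refining.2; exact.
Qed.

End refining_sequence.

(** The lemma of Borel and Cantelli, with the exceptional set enlarged to a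
    Borel one: the product to which Fubini's theorem applies is that of the
    Borel spaces, not of their completions. *)
Lemma fair_coin_eventually (R : realType) (F : nat -> set (coin_space R)) (C : R) :
  (forall t, measurable (F t)) -> (forall t, prob (fair_coin R) (F t) <= C / 2 ^+ t) ->
  exists V : set (borel_bseq R), [/\ measurable V, coin R V = 0%E &
    forall x, ~ V x -> exists s, forall t, (s <= t)%N -> ~ F t x].
Proof.
move=> mF PF.
have C0 : 0 <= C by have := le_trans (prob_ge0 _ _) (PF 0%N); rewrite expr0 divr1.
have lim0 : fair_coin R (lim_sup_set F) = 0%E.
  apply: lim_sup_set_cvg0 => //.
  apply: (@le_lt_trans _ _ (2 * C)%:E); last exact: ltry.
  apply: lime_le; first by apply: is_cvg_nneseries => n _ _.
  apply: nearW => n.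
  apply: (@le_trans _ _ (\sum_(0 <= i < n) (C / 2 ^+ i)%:E)%E).
    by apply: lee_sum => i _; rewrite [leLHS](probE (fair_coin R) (mF i)) lee_fin.
  rewrite sumEFin lee_fin.
  suff -> : \sum_(0 <= i < n) C / 2 ^+ i = 2 * C - 2 * C / 2 ^+ n by rewrite lerBlDr lerDl divr_ge0 ?mulr_ge0.
  elim: n => [|n IH]; first by rewrite big_geq// expr0 divr1 subrr.
  rewrite big_nat_recr//= IH exprS; field.
  by rewrite expf_neq0.
have mL : measurable (lim_sup_set F).
  by apply: bigcap_measurableType => n _; exact: bigcup_measurable.
have [V [mV LV V0]] := borel_hull mL.
exists V; split=> //.
  rewrite -fair_coin_borel//; apply/eqP; rewrite -measure_le0.
  have -> : (V : set (coin_space R)) = lim_sup_set F `|` (V `\` lim_sup_set F) by rewrite setDUK.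
  have mVL : measurable (V `\` lim_sup_set F : set (coin_space R)).
    by apply: measurableD => //; exact: measurable_borel.
  apply: le_trans (measureU2 _ mL mVL) _.
  by rewrite [X in (X + _)%E]lim0 add0e [leLHS]V0.
move=> x nVx; apply: contrapT => /forallNP h; apply: nVx; apply: LV => n _.
by have /existsNP[t /not_implyP[nt /contrapT Ft]] := h n; exists t.
Qed.

(** * The scrambling pattern *)

(** The pairs [(i, k)] are coded by numbers [t]: those with [i = 0] give a
    colour common to all [w], and each other [i] is devoted to the bit
    [w i.-1]. The second component makes each [i] occur infinitely often. *)
Definition color (w : nat -> bool) (t : nat) : bool :=
  if @unpickle (nat * nat)%type t is Some (i.+1, _) then w i else false.

Lemma pickle_unbounded (i s : nat) : exists k, (s <= @pickle (nat * nat)%type (i, k))%N.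
Proof.
apply: contrapT => /forallNP h.
have lt k : (@pickle (nat * nat)%type (i, k) < s)%N by rewrite ltnNge; apply/negP/h.
have inj : injective (fun k : 'I_s.+1 => Ordinal (lt k)).
  by move=> k l [] /(pcan_inj pickleK) [] /val_inj.
by have := leq_card _ inj; rewrite !card_ord ltnn.
Qed.

Lemma color_agree s : exists t, (s <= t)%N /\ forall w w', color w t = color w' t.
Proof.
have [k sk] := pickle_unbounded 0 s.
by exists (@pickle (nat * nat)%type (0, k)%N); split=> // w w'; rewrite /color pickleK.
Qed.

Lemma color_differ w w' : w <> w' -> forall s, exists t, (s <= t)%N /\ color w t != color w' t.
Proof.
move=> ww' s; have [i wi] : exists i, w i <> w' i.
  by apply: contrapT => /forallNP h; apply: ww'; apply/funext => i; apply: contrapT; exact: h.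
have [k sk] := pickle_unbounded i.+1 s.
by exists (@pickle (nat * nat)%type (i.+1, k)%N); split=> //; rewrite /color pickleK; exact/eqP.
Qed.

Section twist.
Variable lev : nat -> nat.
Hypothesis lev_grow : forall t, (2 * lev t + t.+1 <= lev t.+1)%N.

Lemma lev_le s t : (s <= t)%N -> (lev s <= lev t)%N.
Proof.
move=> /subnK <-; elim: (t - s)%N => // n IH.
by rewrite addSn (leq_trans IH)//; have := lev_grow (n + s)%N; lia.
Qed.

Lemma leq_lev t : (t <= lev t)%N.
Proof. by case: t => // t; have := lev_grow t; lia. Qed.

(** The least [t] such that [s < 4 ^ lev t]; the search up to [s] is enough,
    because [t <= lev t]. *)
Definition shell s := find (fun t => s < 2 ^ (lev t).*2)%N (iota 0 s.+1).

Lemma shellP t s : (2 ^ (lev t).*2 <= s < 2 ^ (lev t.+1).*2)%N -> shell s = t.+1.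
Proof.
move=> /andP[ts st]; rewrite /shell.
have tS : (t.+1 < s.+1)%N.
  rewrite ltnS (leq_trans _ ts)// (leq_trans (ltn_expl t (ltnSn 1)))//.
  by rewrite leq_exp2l//; have := leq_lev t; lia.
have hs : has (fun t => s < 2 ^ (lev t).*2)%N (iota 0 s.+1).
  by apply/hasP; exists t.+1; rewrite ?mem_iota.
apply/eqP; rewrite eqn_leq; apply/andP; split; rewrite leqNgt; apply/negP => lt.
  by have := @before_find _ 0%N _ (iota 0 s.+1) _ lt; rewrite nth_iota// add0n st.
have := nth_find 0%N hs; rewrite nth_iota ?add0n; last by rewrite (leq_trans lt)// ltnW.
set f := find _ _ in lt *; move=> sf.
have : (2 ^ (lev f).*2 <= 2 ^ (lev t).*2)%N by rewrite leq_exp2l// leq_double lev_le.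
by lia.
Qed.

Definition twist (w x : nat -> bool) : nat -> bool :=
  fun i => x i (+) (odd i && color w (shell i./2)).

Lemma base_twist w x : base (twist w x) = base x.
Proof. by apply/funext => i; rewrite /base /twist odd_double addbF. Qed.

Lemma scen_twist w x s : scen (twist w x) s = scen x s (+) color w (shell s).
Proof. by rewrite /scen /twist /= odd_double /= uphalf_double. Qed.

Lemma twist_inj x : injective (twist^~ x).
Proof.
move=> w w' e; apply: contrapT => ww'.
have [[|t] [// _ /negP]] := color_differ ww' 1.
apply; apply/eqP; have := congr1 (fun z => scen z (2 ^ (lev t).*2)) e.
rewrite !scen_twist (@shellP t); first exact: addbI.
rewrite leqnn ltn_exp2l//; have := lev_grow t; lia.
Qed.

Context {R : realType}.
Local Notation B := (borel_bseq R).

Lemma measurable_twist : measurable_fun setT ((fun p => twist p.1 p.2) : B * B -> B).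
Proof.
apply: measurable_bseq => i; rewrite /twist.
have m1 k b : measurable [set p : B * B | p.1 k = b].
  by have := @measurable_fst _ _ B B measurableT _ (@measurable_coord R k b); rewrite setTI.
have m2 k b : measurable [set p : B * B | p.2 k = b].
  by have := @measurable_snd _ _ B B measurableT _ (@measurable_coord R k b); rewrite setTI.
have plain : measurable [set p : B * B | p.2 i (+) false].
  rewrite [X in measurable X](_ : _ = [set p : B * B | p.2 i = true])//.
  by apply/seteqP; split=> p /=; rewrite addbF.
case: (odd i) => //=; rewrite /color; case: unpickle => [[[|k] _]|] //.
rewrite [X in measurable X](_ : _ = ([set p : B * B | p.2 i = true] `&` [set p | p.1 k = false]) `|`
   ([set p : B * B | p.2 i = false] `&` [set p | p.1 k = true])).
  by apply: measurableU; exact: measurableI.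
by apply/seteqP; split=> p /=; case: (p.2 i); case: (p.1 k); rewrite /=; intuition.
Qed.

Lemma coin_twist w (A : set B) : measurable A -> coin R ((fun x => twist w x) @^-1` A) = coin R A.
Proof. by move=> mA; apply: (@coin_signed_perm R id (fun i => odd i && color w (shell i./2))). Qed.

End twist.

(** * Counting along orbits *)

Section counting.
Context d (X : measurableType d) {R : realType} (T : X -> X).

Lemma count_exceptions N (Q Z : pred 'I_N) (D : set X) x x' :
  (forall n, Q n -> [\/ Z n, D (iter n T x) | D (iter n T x')]) ->
  #|Q|%:R <= #|Z|%:R + N%:R * (birkhoff R T N D x + birkhoff R T N D x').
Proof.
move=> QZ; have [N0|N0] := posnP N.
  rewrite (_ : #|Q| = 0%N).
    by rewrite addr_ge0// mulr_ge0// addr_ge0// birkhoff_ge0.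
  by apply/eqP; rewrite -leqn0 (leq_trans (max_card _))// card_ord N0.
have NR : N%:R != 0 :> R by rewrite pnatr_eq0 -lt0n.
rewrite mulrDr /birkhoff !mulVKf// -!sum1_card !natr_sum.
rewrite [X in X <= _]big_mkcond [X in X + _]big_mkcond -!big_split /=.
apply: ler_sum => n _; rewrite !indicE.
have p1 (b : bool) : 0 <= b%:R :> R by [].
case: ifPn => [/QZ|_]; last by case: ifP => _; rewrite !addr_ge0.
case=> [Zn|Dx|Dx].
- by rewrite (_ : (n \in Z) = true)// lerDl addr_ge0.
- by rewrite (mem_set Dx) addrCA lerDl addr_ge0//; case: ifP.
- by rewrite (mem_set Dx) addrA lerDr addr_ge0//; case: ifP.
Qed.

Lemma card_early N a : (#|[pred n : 'I_N | n < a]| <= a)%N.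
Proof.
case: a => [|a]; first by rewrite (eq_card0 (A := [pred n : 'I_N | n < 0]))%N.
rewrite -[leqRHS]card_ord.
rewrite -(card_in_imset (f := fun n : 'I_N => inord n : 'I_a.+1)).
  exact: max_card.
move=> m n; rewrite !inE => ma na /(congr1 (@nat_of_ord _)).
by rewrite !inordK// => /val_inj.
Qed.

(** Passage from the times [0 <= n < N] of the ergodic averages to the times
    [1 <= n <= N] of the densities; the times [n < a] are given up. *)
Lemma card_shift N a (E : nat -> Prop) : (0 < a)%N ->
  (N - a <= #|[pred n : 'I_N.+1 | (0 < n)%N && `[<E n>]]| +
     #|[pred n : 'I_N | (a <= n)%N && ~~ `[<E n>]]|)%N.
Proof.
move=> a0; have := cardC [pred n : 'I_N | (n < a)%N]; rewrite card_ord.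
have le1 := card_early N a.
set c1 := #|[pred n : 'I_N | (n < a)%N]| in le1 *.
have : (#|[predC [pred n : 'I_N | (n < a)%N]]| <=
    #|[pred n : 'I_N | (a <= n)%N && `[<E n>]]| + #|[pred n : 'I_N | (a <= n)%N && ~~ `[<E n>]]|)%N.
  rewrite -cardUI (leq_trans _ (leq_addr _ _))//; apply: subset_leq_card.
  apply/fintype.subsetP => n; rewrite !inE -leqNgt => ->.
  by rewrite /=; case: `[<_>].
have : (#|[pred n : 'I_N | (a <= n)%N && `[<E n>]]| <=
    #|[pred n : 'I_N.+1 | (0 < n)%N && `[<E n>]]|)%N.
  have winj : injective (widen_ord (leqnSn N)) by move=> m n [] /val_inj.
  rewrite -(card_imset _ winj).
  apply: subset_leq_card; apply/fintype.subsetP => _ /imsetP[n + ->]; rewrite !inE /=.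
  by move=> /andP[an ->]; rewrite (leq_trans a0 an).
move=> h1 h2 h3; rewrite leq_subLR -[leqLHS]h3; apply: leq_add => //.
apply: leq_trans h2 _; by rewrite leq_add2r.
Qed.

End counting.

Section density.
Context {R : realType}.

Lemma small_power (e : R) : 0 < e -> exists q, forall t, (q <= t)%N -> (2 ^+ t)^-1 <= e.
Proof.
move=> e0; exists (Num.truncn e^-1).+1 => t qt.
rewrite -[e]invrK lef_pV2 ?posrE ?invr_gt0 ?exprn_gt0//.
apply: le_trans (ltW (truncnS_gt _)) _; rewrite -natrX ler_nat.
exact: leq_trans qt (ltnW (ltn_expl t (ltnSn 1))).
Qed.

Lemma increasing_ge (m : nat -> nat) : increasing_pos_seq m -> forall i, (i < m i)%N.
Proof.
move=> [m0 mm]; elim=> [|i IH]; first exact: m0.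
exact: leq_ltn_trans IH (mm _ _ (ltnSn i)).
Qed.

Lemma upper_density_failures (E : nat -> Prop) (c : R) : 0 < c ->
  (forall e : R, 0 < e -> forall M, exists N a, [/\ (M <= N)%N, (0 < a)%N,
     a%:R <= e * N%:R &
     #|[pred n : 'I_N | (a <= n)%N && ~~ `[<E n>]]|%:R <= N%:R * (1 - c + e)]) ->
  exists m, [/\ increasing_pos_seq m, forall i, E (m i) & (c%:E <= upper_density R m)%E].
Proof.
move=> c0 fail; apply: upper_density_enumerate c0 _ => e e0 M.
have e20 : 0 < e / 2 by rewrite divr_gt0.
have arith (n a p q : R) : a <= e / 2 * n -> q <= n * (1 - c + e / 2) -> n <= a + p + q ->
    (c - e) * n <= p by lra.
have [N [a [MN a0 aN FN]]] := fail _ e20 M.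
exists N; split=> //; have := card_shift N E a0.
rewrite leq_subLR addnA -(ler_nat R) !natrD; apply: arith aN FN.
Qed.

End density.

(** * Twisted pairs *)

Section pairs.
Context {R : realType}.
Local Notation T := skew.
Variable lev : nat -> nat.
Hypothesis lev_grow : forall t, (2 * lev t + t.+1 <= lev t.+1)%N.
Variables (x : nat -> bool) (w w' : nat -> bool).
Local Notation tw := (twist lev).
Variable t : nat.
Local Notation j := (lev t.+1).
Hypothesis cf : carry_free j (base x).

(** The times when the walk is not in the shell [t.+1]; at the others, every
    small translate of its position is in the shell too. *)
Definition outside : pred 'I_(times j) := fun n => (walk j (base x) n < 2 ^ (lev t).*2)%N.

(** The walk spends at most [4 ^ lev t * 4 ^ j] of the [8 ^ j] times there, and
    [j] exceeds [2 * lev t] by [t.+1]. *)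
Lemma card_outside : #|outside|%:R <= (times j)%:R / 2 ^+ t.+1 :> R.
Proof.
rewrite ler_pdivlMr ?exprn_gt0// -natrX -natrM ler_nat.
have le : (#|outside| <= 2 ^ (lev t).*2 * 2 ^ j.*2)%N.
  apply: leq_trans (card_walk j (base x) 0 (2 ^ (lev t).*2)).
  by apply: subset_leq_card; apply/fintype.subsetP => n; rewrite inE Nat.lxor_0_r.
apply: (@leq_trans (2 ^ (lev t).*2 * 2 ^ j.*2 * 2 ^ t.+1)); first by rewrite leq_mul2r le orbT.
by rewrite -!expnD leq_exp2l//; have := lev_grow t; lia.
Qed.

Lemma outside_shell n s : (s < 2 ^ lev t)%N -> ~~ outside n ->
  shell lev (s ^^ walk j (base x) n) = t.+1.
Proof.
move=> st; rewrite -leqNgt => nt; apply: (shellP lev_grow).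
apply: (@lxor_shell (lev t)) => //; first by lia.
by rewrite nt walk_lt.
Qed.

Lemma scen_twist_iter u (n : 'I_(times j)) s :
  scen (iter n T (tw u x)) s = scen x (s ^^ walk j (base x) n) (+)
    color u (shell lev (s ^^ walk j (base x) n)).
Proof.
have cfu : carry_free j (base (tw u x)) by rewrite base_twist.
by rewrite (scen_iter cfu (ltnW (ltn_ord n))) base_twist scen_twist.
Qed.

(** The twists do not touch the digits, and they flip the scenery on the whole
    shell alike. *)
Lemma twist_agree K n : color w t.+1 = color w' t.+1 -> (K <= lev t)%N -> ~~ outside n ->
  agree K (iter n T (tw w x)) (iter n T (tw w' x)).
Proof.
move=> ww' Kt nout i iK; rewrite -(odd_double_half i); case: (odd i); last first.
  rewrite add0n -[iter n T (tw w x) _]/(base (iter n skew (tw w x)) _).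
  by rewrite -[iter n T (tw w' x) _]/(base (iter n skew (tw w' x)) _) !base_iter !base_twist.
rewrite add1n -[iter n T (tw w x) _]/(scen (iter n skew (tw w x)) _).
rewrite -[iter n T (tw w' x) _]/(scen (iter n skew (tw w' x)) _) !scen_twist_iter.
rewrite outside_shell ?ww'//.
by apply: leq_ltn_trans (ltn_expl (lev t) (ltnSn 1)); lia.
Qed.

Lemma twist_differ n : color w t.+1 != color w' t.+1 -> ~~ outside n ->
  scen (iter n T (tw w x)) 0 != scen (iter n T (tw w' x)) 0.
Proof.
move=> ww' nout; rewrite !scen_twist_iter outside_shell ?expn_gt0//.
by apply: contra_neq ww'; exact: addbI.
Qed.

End pairs.

Section levels.
Context {R : realType}.
Local Notation X := (coin_space R).
Local Notation mu := (fair_coin R).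
Local Notation prob := (prob mu).
Local Notation T := (skew : X -> X).

(** Levels are chosen one after the other: [lev t] is so large that the sets
    [D l], for [l <= t], are equidistributed at scale [lev t]. *)
Lemma levels_exist (K : nat -> nat) (D : nat -> set X) (c : nat -> R) :
  (forall l, measurable (D l)) -> (forall l, 0 < c l) ->
  exists lev : nat -> nat, [/\ forall t, (2 * lev t + t.+1 <= lev t.+1)%N,
    forall t, (K t.+1 <= lev t)%N &
    forall t l, (l <= t)%N ->
      prob (deviation mu T (D l) (c l) (lev t)) <= t.+1%:R^-1 / 2 ^+ t].
Proof.
move=> mD c0.
have e0 t : 0 < t.+1%:R^-1 / 2 ^+ t :> R by rewrite divr_gt0 ?invr_gt0 ?exprn_gt0.
have /choice[J JP] (p : nat * nat) : exists J, forall j, (J <= j)%N ->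
    prob (deviation mu T (D p.1) (c p.1) j) <= p.2.+1%:R^-1 / 2 ^+ p.2.
  exact: (equidistributed_skew (mD p.1) (c0 p.1) (e0 p.2)).
pose N t := (\max_(l < t.+1) J (nat_of_ord l, t))%N.
pose lev := fix lev t := if t is s.+1 then (2 * lev s + s.+1 + N t + K t.+1)%N else (N 0 + K 1)%N.
have Nlev t : (N t <= lev t)%N by case: t => [|t] /=; lia.
exists lev; split=> [t|[|t]|t l lt] /=; try lia.
apply: (JP (l, t)); rewrite (leq_trans _ (Nlev t))// /N.
have lt' : (l < t.+1)%N by [].
exact: (leq_bigmax (F := fun l : 'I_t.+1 => J (nat_of_ord l, t)) (Ordinal lt')).
Qed.

End levels.

(** The sets [D' t] are exceptional for the prediction of the atom of [P t] from
    [K t] coordinates, the sets [D l] for the prediction of the scenery at site 0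
    from the atom of [P (k l)]. The former shrink fast, so Markov's inequality is
    enough to see that they are rarely visited; the latter have a fixed size,
    and equidistribution is needed at every scale. *)
Section chaos.
Context {R : realType}.
Local Notation X := (coin_space R).
Local Notation mu := (fair_coin R).
Local Notation prob := (prob mu).
Local Notation T := (skew : X -> X).
Let T_mp : measure_preserving mu T := fair_coin_skew.
Variable P : nat -> finite_partition X.
Hypothesis P_refining : refining mu P.

Variables (K : nat -> nat) (D' : nat -> set X).
Hypothesis K_decides : forall t, [/\ measurable (D' t), prob (D' t) <= (4 ^+ t)^-1 &
  forall x y, agree (K t) x y -> ~ D' t x -> ~ D' t y -> same_atom (P t) x y].
Variables (k : nat -> nat) (D : nat -> set X).
(** At good scales each orbit of a pair spends at most twice this proportion of
    the times in [D l]; for two orbits that makes less than [l.+1%:R^-1]. *)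
Definition tolerance (l : nat) : R := (8 * l.+1%:R)^-1.
Hypothesis k_decides : forall l, [/\ measurable (D l), prob (D l) <= tolerance l &
  forall x y, same_atom (P (k l)) x y -> ~ D l x -> ~ D l y -> scen x 0 -> scen y 0].
Variable lev : nat -> nat.
Hypothesis lev_grow : forall t, (2 * lev t + t.+1 <= lev t.+1)%N.
Hypothesis lev_K : forall t, (K t.+1 <= lev t)%N.
Hypothesis lev_dev : forall t l, (l <= t)%N ->
  prob (deviation mu T (D l) (tolerance l) (lev t)) <= t.+1%:R^-1 / 2 ^+ t.

Definition bad t : set X := [set x | ~~ carry_free (lev t) (base x)] `|`
  ((\bigcup_(l < t.+1) deviation mu T (D l) (tolerance l) (lev t)) `|`
   [set x | (2 ^+ t)^-1 < birkhoff R T (times (lev t)) (D' t) x]).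

Lemma bad_small t : measurable (bad t) /\ prob (bad t) <= 3 / 2 ^+ t.
Proof.
have [pB mB] := @prob_carry R (lev t).
have mdev l : measurable (deviation mu T (D l) (tolerance l) (lev t)).
  by have [mD _ _] := k_decides l; exact: measurable_deviation.
have mU : measurable (\bigcup_(l < t.+1) deviation mu T (D l) (tolerance l) (lev t)).
  by apply: bigcup_measurable => l _.
have [mD' pD' _] := K_decides t.
have mM : measurable [set x | (2 ^+ t)^-1 < birkhoff R T (times (lev t)) (D' t) x].
  exact/measurable_gt_rv/(bounded_birkhoff T_mp).
have mUM := measurableU _ _ mU mM.
split; first exact: measurableU.
rewrite (_ : 3 / 2 ^+ t = (2 ^+ t)^-1 + ((2 ^+ t)^-1 + (2 ^+ t)^-1)); last by ring.
apply: le_trans (probU_le mu mB mUM) _; apply: lerD.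
  rewrite pB lef_pV2 ?posrE ?exprn_gt0// ler_eXn2l ?ltr1n//.
  exact: (leq_lev lev_grow).
apply: le_trans (probU_le mu mU mM) _; apply: lerD.
  apply: le_trans (prob_le_sum mu mU (fun l : 'I_t.+1 => mdev l) _) _.
    by move=> x [l /= lt dx]; exists (Ordinal lt).
  apply: (@le_trans _ _ (\sum_(l < t.+1) (t.+1%:R^-1 / 2 ^+ t))).
    by apply: ler_sum => l _; apply: lev_dev; rewrite -ltnS.
  by rewrite sumr_const card_ord -[leLHS]mulr_natl mulrA divff ?mul1r// pnatr_eq0.
apply: le_trans (markov_birkhoff T_mp (times_gt0 _) mD' _) _; first by rewrite invr_gt0 exprn_gt0.
rewrite invrK (le_trans (ler_wpM2r _ pD'))// ?exprn_ge0//.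
rewrite (_ : 4 = 2 * 2 :> R) ?exprMn; last by rewrite -natrM.
by rewrite invfM -mulrA mulVf ?mulr1// expf_neq0.
Qed.

Section one_pair.
Variables (x w w' : nat -> bool) (s : nat).
Local Notation tw := (twist lev).
Hypothesis good_w : forall t, (s <= t)%N -> ~ bad t (tw w x).
Hypothesis good_w' : forall t, (s <= t)%N -> ~ bad t (tw w' x).

Let carry_good t : (s <= t)%N -> carry_free (lev t) (base x).
Proof.
move=> st; apply: contrapT => /negP nc; apply: (good_w st); left.
by rewrite /= base_twist.
Qed.

Let good_D u t l : (forall t, (s <= t)%N -> ~ bad t (tw u x)) -> (s <= t)%N -> (l <= t)%N ->
  birkhoff R T (times (lev t)) (D l) (tw u x) <= 2 * tolerance l.
Proof.
move=> gu st lt; rewrite leNgt; apply/negP => big; apply: (gu t st); right; left.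
exists l => //; rewrite /deviation /=; apply: lt_le_trans (ler_norm _).
have [_ pD _] := k_decides l.
rewrite ltrBrDl (le_lt_trans _ big)//; lra.
Qed.

Let good_D' u t : (forall t, (s <= t)%N -> ~ bad t (tw u x)) -> (s <= t)%N ->
  birkhoff R T (times (lev t)) (D' t) (tw u x) <= (2 ^+ t)^-1.
Proof.
by move=> gu st; rewrite leNgt; apply/negP => big; apply: (gu t st); right; right.
Qed.

Let count_same t : (s <= t.+1)%N -> color w t.+1 = color w' t.+1 ->
  #|[pred n : 'I_(times (lev t.+1)) |
     ~~ `[<same_atom (P t.+1) (iter n T (tw w x)) (iter n T (tw w' x))>]]|%:R <=
  (times (lev t.+1))%:R * (3 / 2 ^+ t.+1) :> R.
Proof.
move=> st cww'; have [_ _ dec] := K_decides t.+1.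
have := @count_exceptions _ X R T _ [pred n : 'I_(times (lev t.+1)) |
     ~~ `[<same_atom (P t.+1) (iter n T (tw w x)) (iter n T (tw w' x))>]]
  (outside (lev := lev) x (t := t)) (D' t.+1) (tw w x) (tw w' x).
move=> H; apply: le_trans (H _) _ => {H}.
  move=> n /asboolPn ns; have [ot|no] := boolP (outside x n); first by constructor 1.
  have [Dw|nDw] := pselect (D' t.+1 (iter n T (tw w x))); first by constructor 2.
  have [Dw'|nDw'] := pselect (D' t.+1 (iter n T (tw w' x))); first by constructor 3.
  exfalso; apply: ns; apply: dec => //.
  exact: (twist_agree lev_grow (carry_good st) cww' (lev_K t) no).
have h1 := @card_outside R lev lev_grow x t (carry_good st).
have h2 := good_D' good_w st; have h3 := good_D' good_w' st.
have NR : 0 <= (times (lev t.+1))%:R :> R by [].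
apply: le_trans (lerD h1 (ler_wpM2l NR (lerD h2 h3))) _.
by rewrite -mulrDr -[3]/(1 + (1 + 1)) ![(_ + _) / _]mulrDl !mul1r.
Qed.

Let count_differ t l : (s <= t.+1)%N -> (l <= t.+1)%N -> color w t.+1 != color w' t.+1 ->
  #|[pred n : 'I_(times (lev t.+1)) |
     `[<same_atom (P (k l)) (iter n T (tw w x)) (iter n T (tw w' x))>]]|%:R <=
  (times (lev t.+1))%:R * ((2 ^+ t.+1)^-1 + 4 * tolerance l) :> R.
Proof.
move=> st lt cww'; have [_ _ dec] := k_decides l.
have := @count_exceptions _ X R T _ [pred n : 'I_(times (lev t.+1)) |
     `[<same_atom (P (k l)) (iter n T (tw w x)) (iter n T (tw w' x))>]]
  (outside (lev := lev) x (t := t)) (D l) (tw w x) (tw w' x).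
move=> H; apply: le_trans (H _) _ => {H}.
  move=> n /asboolP ns; have [ot|no] := boolP (outside x n); first by constructor 1.
  have [Dw|nDw] := pselect (D l (iter n T (tw w x))); first by constructor 2.
  have [Dw'|nDw'] := pselect (D l (iter n T (tw w' x))); first by constructor 3.
  have /eqP := twist_differ lev_grow (carry_good st) cww' no; case.
  by apply/idP/idP; apply: dec => //; exact: same_atom_sym.
have h1 := @card_outside R lev lev_grow x t (carry_good st).
have h2 := good_D good_w st lt; have h3 := good_D good_w' st lt.
have NR : 0 <= (times (lev t.+1))%:R :> R by [].
apply: le_trans (lerD h1 (ler_wpM2l NR (lerD h2 h3))) _.
by rewrite -mulrDr ler_wpM2l// lerD2l; lra.
Qed.

Let times_ge t : (t <= times (lev t))%N.
Proof.
apply: leq_trans (ltnW (ltn_expl t (ltnSn 1))) _.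
by rewrite /times leq_exp2l//; have := leq_lev lev_grow t; lia.
Qed.

Let times_grow t : (times (lev t) * 2 ^ t.+1 <= times (lev t.+1))%N.
Proof. by rewrite /times -expnD leq_exp2l//; have := lev_grow t; lia. Qed.

Let times_le t u : (t <= u)%N -> (times (lev t) <= times (lev u))%N.
Proof. by move=> tu; rewrite /times leq_exp2l// leq_mul2l (lev_le lev_grow tu) orbT. Qed.

(** The times are taken, for every [t], among those between [8 ^ lev t] and
    [8 ^ lev t.+1], and the points have to share the atom of [P t.+1]; therefore
    they eventually share that of every [P i]. On the infinitely many shells
    of common colour this loses a proportion of the times that tends to 0. *)
Lemma pair_proximal : exists m, [/\ increasing_pos_seq m, upper_density R m = 1%E &
  forall i, \forall n \near \oo,
    same_atom (P i) (iter (m n) T (tw w x)) (iter (m n) T (tw w' x))].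
Proof.
pose E n := exists t, [/\ (times (lev t) <= n)%N, (n < times (lev t.+1))%N &
  same_atom (P t.+1) (iter n T (tw w x)) (iter n T (tw w' x))].
have [||m [m_incr mE m1]] := @upper_density_failures R E 1.
- exact: ltr01.
- move=> e e0 M; have [q qP] := small_power (divr_gt0 e0 (ltr0n _ 3)).
  have [[|t] [+ cl]] := color_agree (q + s + M).+1; first by [].
  rewrite ltnS => qt.
  have st : (s <= t.+1)%N by lia.
  have q1 : (2 ^+ t.+1)^-1 <= e / 3 by apply: qP; lia.
  have q0 : 0 < 2 ^+ t.+1 :> R by rewrite exprn_gt0.
  exists (times (lev t.+1)), (times (lev t)); split.
  + by apply: leq_trans (times_ge _); lia.
  + exact: times_gt0.
  + apply: (@le_trans _ _ ((times (lev t.+1))%:R / 2 ^+ t.+1)).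
      by rewrite ler_pdivlMr// -natrX -natrM ler_nat times_grow.
    rewrite mulrC ler_wpM2r// (le_trans q1)//; lra.
  + apply: le_trans (le_trans (count_same st (cl w w')) _).
      rewrite ler_nat; apply: subset_leq_card; apply/fintype.subsetP => n; rewrite !inE.
      move=> /andP[an /asboolPn nE]; apply/asboolPn => sm; apply: nE; exists t; split=> //.
    rewrite ler_wpM2l//; lra.
exists m; split=> //.
  by apply/eqP; rewrite eq_le upper_density_le1.
move=> i; exists (times (lev i)) => // n /= ni.
have [t [_ nt sm]] := mE n.
apply: same_atom_refine P_refining _ _ _ _ _ sm.
rewrite leqNgt; apply/negP => ti; have := times_le (ltnW ti).
have := increasing_ge m_incr n; lia.
Qed.

(** On the infinitely many shells where the colours differ, the points are
    separated at all times except for a proportion of [4 * tolerance l], up to an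
    arbitrarily small error. *)
Lemma pair_distal l (eta : R) : w <> w' -> 0 < eta -> l.+1%:R^-1 <= 1 - eta ->
  exists m, [/\ increasing_pos_seq m, (eta%:E <= upper_density R m)%E &
    forall i, ~ same_atom (P (k l)) (iter (m i) T (tw w x)) (iter (m i) T (tw w' x))].
Proof.
move=> ww' eta0 leta.
pose E n := ~ same_atom (P (k l)) (iter n T (tw w x)) (iter n T (tw w' x)).
have [|m [m_incr mE meta]] := @upper_density_failures R E eta eta0; last by exists m.
move=> e e0 M; have [q qP] := small_power e0.
have [[|t] [+ cl]] := color_differ ww' (q + s + M + l).+1; first by [].
rewrite ltnS => qt.
have st : (s <= t.+1)%N by lia.
have lt : (l <= t.+1)%N by lia.
have q1 : (2 ^+ t.+1)^-1 <= e by apply: qP; lia.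
have q0 : 0 < 2 ^+ t.+1 :> R by rewrite exprn_gt0.
exists (times (lev t.+1)), 1%N; split=> //.
- by apply: leq_trans (times_ge _); lia.
- rewrite mulrC -ler_pdivrMr// div1r.
  apply: (@le_trans _ _ (2 ^+ t.+1)); last first.
    by rewrite -natrX ler_nat (leq_trans _ (times_grow t))// leq_pmull// times_gt0.
  by rewrite -[leRHS]invrK lef_pV2 ?posrE ?invr_gt0.
- apply: le_trans (le_trans (count_differ st lt cl) _).
    rewrite ler_nat; apply: subset_leq_card; apply/fintype.subsetP => n; rewrite !inE.
    move=> /andP[_ /asboolPn nE]; apply: contrapT => h; apply: nE => sm; apply: h; exact: sm.
  rewrite ler_wpM2l// /tolerance invfM.
  have arith (u v : R) : 0 < u -> u <= 1 - eta -> v <= e -> v + 4 * (8^-1 * u) <= 1 - eta + e.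
    by lra.
  by apply: arith => //; rewrite invr_gt0.
Qed.

End one_pair.
End chaos.

(** * Existence of the system *)

(** The parameters [w] and [w'] enter the choice of the constants nowhere: [k] and
    the levels depend on the partitions only, which makes the scrambling
    uniform. *)
Lemma chaotic_skew (R : realType) : uniformly_chaotic (fair_coin R) (skew : coin_space R -> coin_space R).
Proof.
move=> P P_ref; pose X := coin_space R.
have /choice[K /choice[D' K_dec]] (t : nat) : exists K D', [/\ measurable (D' : set X),
    prob (fair_coin R) D' <= (4 ^+ t)^-1 &
    forall x y, agree K x y -> ~ D' x -> ~ D' y -> same_atom (P t) x y].
  apply: (@partition_decided _ X R (fair_coin R) agree agree_le) => [A|]; first exact: coordinate_approximable.
  by rewrite invr_gt0 exprn_gt0.
have mA : measurable ([set x | scen x 0] : set X).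
  rewrite [X in measurable X](_ : _ = [set x | x 1%N = true])//.
  exact: (measurable_borel (@measurable_coord R 1%N true)).
have /choice[k /choice[D k_dec]] (l : nat) : exists k D, [/\ measurable (D : set X),
    prob (fair_coin R) D <= tolerance l &
    forall x y, same_atom (P k) x y -> ~ D x -> ~ D y -> scen x 0 -> scen y 0].
  have t0 : 0 < tolerance l :> R by rewrite /tolerance invr_gt0 mulr_gt0.
  have approx := refining_approximable (@fair_coin_complete R) P_ref mA.
  exact: (approximable_decided approx t0).
have mD l : measurable (D l) by have [] := k_dec l.
have [|lev [lev_grow lev_K lev_dev]] := @levels_exist R K D tolerance mD.
  by move=> l; rewrite /tolerance invr_gt0 mulr_gt0.
have bad_small := bad_small K_dec k_dec lev_grow lev_dev.
have [V [mV V0 Vev]] := fair_coin_eventually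
  (fun t => (bad_small t).1) (fun t => (bad_small t).2).
have [x nc] := uncountable_avoiding (@measurable_twist lev R) (@coin_twist lev R) mV V0.
exists [set twist lev w x | w in [set w | ~ V (twist lev w x)]]; split.
  move=> /countable_injP[f finj]; apply: nc; apply/countable_injP.
  exists (fun w => f (twist lev w x)) => w w'; rewrite !inE => nw nw' e.
  apply: (twist_inj lev_grow (x := x)); apply: finj => //; rewrite inE.
    by exists w.
  by exists w'.
(* The least [l] with [l.+1%:R^-1 < 1 - eta]. *)
pose l (eta : R) := Num.truncn (1 - eta)^-1.
exists (k \o l) => _ _ [w nw <-] [w' nw' <-] ww'.
have [s1 good1] := Vev _ nw; have [s2 good2] := Vev _ nw'.
have good t : (maxn s1 s2 <= t)%N -> ~ @bad R D' D lev t (twist lev w x).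
  by rewrite geq_max => /andP[h _]; exact: good1 h.
have good' t : (maxn s1 s2 <= t)%N -> ~ @bad R D' D lev t (twist lev w' x).
  by rewrite geq_max => /andP[_ h]; exact: good2 h.
split; first exact: (pair_proximal P_ref K_dec lev_grow lev_K good good').
move=> eta /andP[eta0 eta1].
apply: (pair_distal k_dec lev_grow good good') => //.
  by move=> e; apply: ww'; rewrite e.
have eta1' : 0 < 1 - eta by rewrite subr_gt0.
rewrite -[leRHS]invrK lef_pV2 ?posrE ?invr_gt0//.
exact/ltW/truncnS_gt.
Qed.

Theorem theorem7 (R : realType) :
  exists (d : measure_display) (X : measurableType d) (mu : probability X R)
         (T : X -> X),
    [/\ standard_probability mu,
        measure_preserving mu T,
        ergodic mu T,
        KS_entropy mu T = 0%E &
        uniformly_chaotic mu T].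
Proof.
exists _, (coin_space R), (fair_coin R), skew; split.
- exact: standard_fair_coin.
- exact: fair_coin_skew.
- exact: ergodic_skew.
- exact: KS_entropy_skew.
- exact: chaotic_skew.
Qed.
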